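(* Let $X$ and $Y$ be Banach spaces, $\Omega\subset X$ and $F:X\rightrightarrows Y$ be such that $\Omega$ and $\mathrm{gph}\,F$ are closed, $\bar x\in\Omega$, $\bar y\in F(\bar x)$, $L:Y\rightrightarrows Y$, $\delta>0$, and $$\Xi^\delta:=\{\mathrm{cl}\,L(y)\mid y\in L^-(\bar y)\cap B_\delta(\bar y)\}.$$ If condition $(QC)_C$ is satisfied and the triple $\{F,\Omega,\Xi^\delta\}$ is approximately stationary at $(\bar x,\bar y)$, then there is an $M>0$ such that, for any $\varepsilon>0$, there exist $(x_1,y_1)\in\mathrm{gph}\,F\cap B_{\varepsilon}(\bar x,\bar y)$, $x_2\in\Omega\cap B_{\varepsilon}(\bar x)$, $y\in L^-(\bar y)\cap B_\delta(\bar y)$, $y_2\in\mathrm{cl}\,L(y)\cap B_\varepsilon(\bar y)$, and $y^*\in N^C_{\mathrm{cl}\,L(y)}(y_2)+\varepsilon\mathbb B_{Y^*}$ such that $\|y^*\|=1$ and $$0\in D^{*C}F(x_1,y_1)(y^* )+N^C_\Omega(x_2)\cap(M\mathbb B_{X^*})+\varepsilon\mathbb B_{X^*}.$$ If $X$ and $Y$ are Asplund, condition $(QC)_F$ is satisfied (in place of $(QC)_C$) and the triple $\{F,\Omega,\Xi^\delta\}$ is approximately stationary at $(\bar x,\bar y)$, then there is an $M>0$ such that, for any $\varepsilon>0$, there exist $(x_1,y_1)\in\mathrm{gph}\,F\cap B_{\varepsilon}(\bar x,\bar y)$, $x_2\in\Omega\cap B_{\varepsilon}(\bar x)$, $y\in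 L^-(\bar y)\cap B_\delta(\bar y)$, $y_2\in\mathrm{cl}\,L(y)\cap B_\varepsilon(\bar y)$, and $y^*\in N^F_{\mathrm{cl}\,L(y)}(y_2)+\varepsilon\mathbb B_{Y^*}$ such that $\|y^*\|=1$ and $$0\in D^{*F}F(x_1,y_1)(y^* )+N^F_\Omega(x_2)\cap(M\mathbb B_{X^*})+\varepsilon\mathbb B_{X^*}.$$
   Context: Notation: $B_\delta(x)$ is the open ball; $\mathbb B$ (with a subscript for the space) is the open unit ball; $X\times Y$ carries the maximum norm; $d(x,S)=\inf_{u\in S}\|u-x\|$ with $d(x,\emptyset)=+\infty$; $\mathrm{gph}\,F=\{(x,y)\mid y\in F(x)\}$ for a set-valued mapping $F$ (values may be empty); the image of a set under a set-valued mapping is the union of the images of its points; $L^-(y):=L(y)\cup\{y\}$. Normal cones: for a subset $S$ of a normed space $Z$ and $\bar z\in S$, the Fréchet normal cone is $N^F_S(\bar z)=\{z^*\in Z^*\mid \limsup_{S\ni z\to\bar z,\,z\ne\bar z}\langle z^*,z-\bar z\rangle/\|z-\bar z\|\le0\}$; the Clarke tangent cone $T^C_S(\bar z)$ is the set of $w\in Z$ such that for all $z_k\to\bar z$ with $z_k\in S$ and all $t_k\downarrow0$ there are $w_k\to w$ with $z_k+t_kw_k\in S$ for all $k$; the Clarke normal cone is $N^C_S(\bar z)=\{z^*\in Z^*\mid\langle z^*,w\rangle\le0\ \forall w\in T^C_S(\bar z)\}$. Both are empty by convention if $\bar z\notin S$. Coderivatives: for $(x,y)\in\mathrm{gph}\,F$,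 $D^{*C}F(x,y)(y^* )=\{x^*\in X^*\mid(x^*,-y^* )\in N^C_{\mathrm{gph}\,F}(x,y)\}$, and $D^{*F}F(x,y)$ is defined in the same way with $N^F$ in place of $N^C$. A Banach space is Asplund if the dual of each of its separable subspaces is separable. Approximate stationarity: a collection $\{\Xi_1,\ldots,\Xi_n\}$ of families of subsets of a normed space $Z$ is approximately stationary at $\bar z\in Z$ if, for any $\varepsilon>0$, there exist $\rho\in(0,\varepsilon)$, $A_i\in\Xi_i$ and $z_i\in B_\varepsilon(\bar z)$ $(i=1,\ldots,n)$ such that $\max_{1\le i\le n}d(z_i,A_i)<\varepsilon\rho$ and $\bigcap_{i=1}^n(A_i-z_i)\cap(\rho\mathbb B)=\emptyset$. For a family $\Xi$ of subsets of $Y$, the triple $\{F,\Omega,\Xi\}$ is approximately stationary at $(\bar x,\bar y)$ if the pair of families $\Xi_1:=\{\mathrm{gph}\,F\}$, $\Xi_2:=\{\Omega\times A\mid A\in\Xi\}$ of subsets of $X\times Y$ is approximately stationary at $(\bar x,\bar y)$. Condition $(QC)_C$: there is an $\varepsilon>0$ such that $\|x_1^*+x_2^*\|\ge\varepsilon$ for all $(x_1,y_1)\in\mathrm{gph}\,F\cap B_{\varepsilon}(\bar x,\bar y)$, $x_2\in\Omega\cap B_{\varepsilon}(\bar x)$, $x_1^*\in D^{*C}F(x_1,y_1)(\varepsilon\mathbb B_{Y^*})$ and $x_2^*\in N^C_\Omega(x_2)$ such that $\|x_1^*\|+\|x_2^*\|=1$. Condition $(QC)_F$ is the same with $N^F$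 and $D^{*F}$ in place of $N^C$ and $D^{*C}$. *)

(* Defs.v *)
From HB Require Import structures.
From mathcomp Require Import all_boot all_order all_algebra.
From mathcomp Require Import all_classical all_reals all_analysis.

Set Implicit Arguments.
Unset Strict Implicit.
Unset Printing Implicit Defensive.

Import Order.TTheory GRing.Theory Num.Theory.
Import numFieldTopology.Exports numFieldNormedType.Exports.

Local Open Scope classical_set_scope.
Local Open Scope ring_scope.

(** * Topological dual of a normed space *)

Section DualPred.
Context (R : realType) (X : normedModType R).

Definition dual_pred : {pred X -> R^o} :=
  fun f => `[< linear f /\ continuous f >].

Lemma dual_predP (f : X -> R^o) :
  reflect (linear f /\ continuous f) (f \in dual_pred).
Proof. exact: asboolP. Qed.

Lemma dual_pred_submod : submod_closed dual_pred.
Proof.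
split=> [|a f g /dual_predP[lf cf] /dual_predP[lg cg]]; apply/dual_predP.
  split; first by move=> a u v; rewrite /= scaler0 addr0.
  exact: cst_continuous.
split=> [b u v|x].
  rewrite -![(a *: f + g) _]/(a *: f _ + g _) lf lg.
  by rewrite !scalerDr addrACA !scalerA mulrC.
apply: (@cvgD _ _ _ (nbhs x) _ (a \*: f) g _ _ _ (cg x)).
by apply: cvgZl_tmp; exact: cf.
Qed.

HB.instance Definition _ :=
  GRing.isSubmodClosed.Build R (X -> R^o) dual_pred dual_pred_submod.

End DualPred.

Record dual (R : realType) (X : normedModType R) := Dual {
  dual_fun :> X -> R^o ;
  dual_funP : dual_fun \in @dual_pred R X }.

Section DualNormed.
Context (R : realType) (X : normedModType R).

HB.instance Definition _ := [isSub for @dual_fun R X].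
HB.instance Definition _ := [Choice of dual X by <:].
HB.instance Definition _ := [SubChoice_isSubLmodule of dual X by <:].

HB.instance Definition _ (f : dual X) :=
  GRing.isLinear.Build R X R^o *:%R f (proj1 (dual_predP _ (dual_funP f))).

Lemma dual_continuous (f : dual X) : continuous f.
Proof. exact: (proj2 (dual_predP _ (dual_funP f))). Qed.

Definition dual_norm (f : dual X) : R :=
  sup [set `|f x| | x in [set x | `|x| <= 1]].

Lemma dual_norm_has_sup (f : dual X) :
  has_sup [set `|f x| | x in [set x | `|x| <= 1]].
Proof.
split; first by exists `|f 0|; exists 0 => //=; rewrite normr0.
have := @continuous_linear_bounded _ X R^o 0 f (@dual_continuous f 0).
move=> /bounded_funP /(_ 1)[M fM].
by exists M => _ [x x1 <-]; exact: fM.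
Qed.

Lemma dual_norm_ge (f : dual X) x : `|x| <= 1 -> `|f x| <= dual_norm f.
Proof.
move=> x1; apply: ub_le_sup; first exact: (dual_norm_has_sup f).2.
by exists x.
Qed.

Lemma dual_norm_le (f : dual X) M :
  (forall x, `|x| <= 1 -> `|f x| <= M) -> dual_norm f <= M.
Proof.
move=> fM; apply: ge_sup; first exact: (dual_norm_has_sup f).1.
by move=> _ [x x1 <-]; exact: fM.
Qed.

Lemma ler_dual_normD (f g : dual X) :
  dual_norm (f + g) <= dual_norm f + dual_norm g.
Proof.
apply: dual_norm_le => x x1.
by rewrite (le_trans (ler_normD _ _))// lerD// dual_norm_ge.
Qed.

Lemma dual_norm_ge0 (f : dual X) : 0 <= dual_norm f.
Proof. by rewrite (le_trans (normr_ge0 (f 0)))// dual_norm_ge ?normr0. Qed.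

Lemma dual_normZ (a : R) (f : dual X) :
  dual_norm (a *: f) = `|a| * dual_norm f.
Proof.
have le (b : R) (g : dual X) : dual_norm (b *: g) <= `|b| * dual_norm g.
  apply: dual_norm_le => x x1.
  by rewrite -[(b *: g) x]/(b * g x) normrM ler_wpM2l// dual_norm_ge.
apply/eqP; rewrite eq_le le /=.
have [->|a0] := eqVneq a 0; first by rewrite normr0 mul0r dual_norm_ge0.
rewrite -ler_pdivlMl ?normr_gt0// -normfV.
by rewrite (le_trans _ (le _ _))// scalerA mulVf// scale1r.
Qed.

Lemma dual_norm0_eq0 (f : dual X) : dual_norm f = 0 -> f = 0.
Proof.
move=> f0; apply: val_inj; apply/funext => x /=.
have [->|x0] := eqVneq x 0; first by rewrite linear0.
have nx0 : `|x| != 0 by rewrite normr_eq0.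
have : `|f (`|x|^-1 *: x)| <= dual_norm f.
  by apply: dual_norm_ge; rewrite normrZ normfV normr_id mulVf.
rewrite f0 normr_le0 linearZ/= scaler_eq0 invr_eq0 (negbTE nx0)/=.
by move=> /eqP.
Qed.

HB.instance Definition _ := @Lmodule_isNormed.Build R (dual X)
  dual_norm ler_dual_normD dual_normZ dual_norm0_eq0.

End DualNormed.

(** Functionals on [X * Y] are identified with pairs [(f, g)] acting by
    [(x, y) |-> f x + g y]. *)
Section DualPair.
Context (R : realType) (X Y : normedModType R).

Lemma dual_pair_subproof (f : dual X) (g : dual Y) :
  (fun z : X * Y => f z.1 + g z.2 : R^o) \in @dual_pred R (X * Y)%type.
Proof.
apply/dual_predP; split=> [a u v|z].
  by rewrite /= !linearP/= scalerDr addrACA.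
apply: (@cvgD _ _ _ (nbhs z) _ (f \o fst) (g \o snd)).
- exact: continuous_comp (@cvg_fst _ _ _ _ _) (@dual_continuous _ _ f z.1).
- exact: continuous_comp (@cvg_snd _ _ _ _ _) (@dual_continuous _ _ g z.2).
Qed.

Definition dual_pair (f : dual X) (g : dual Y) : dual (X * Y)%type :=
  Dual (dual_pair_subproof f g).

End DualPair.

(** * Asplund spaces *)

Record subspace_of (R : realType) (X : normedModType R) (V : submodClosed X) :=
  SubspaceOf { subspace_val :> X ; subspace_valP : subspace_val \in V }.

Section SubspaceNormed.
Context (R : realType) (X : normedModType R) (V : submodClosed X).

HB.instance Definition _ := [isSub for @subspace_val R X V].
HB.instance Definition _ := [Choice of subspace_of V by <:].
HB.instance Definition _ := [SubChoice_isSubLmodule of subspace_of V by <:].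

Definition subspace_norm (v : subspace_of V) : R := `|val v|.

Lemma ler_subspace_normD (u v : subspace_of V) :
  subspace_norm (u + v) <= subspace_norm u + subspace_norm v.
Proof. by rewrite /subspace_norm raddfD ler_normD. Qed.

Lemma subspace_normZ (a : R) (v : subspace_of V) :
  subspace_norm (a *: v) = `|a| * subspace_norm v.
Proof. by rewrite /subspace_norm linearZ normrZ. Qed.

Lemma subspace_norm0_eq0 (v : subspace_of V) : subspace_norm v = 0 -> v = 0.
Proof. by move=> /normr0_eq0 v0; apply: val_inj; rewrite v0 raddf0. Qed.

HB.instance Definition _ := @Lmodule_isNormed.Build R (subspace_of V)
  subspace_norm ler_subspace_normD subspace_normZ subspace_norm0_eq0.

End SubspaceNormed.

Definition separable (T : topologicalType) :=
  exists2 D : set T, countable D & dense D.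

(* [V] ranges over all linear subspaces, closed or not, with the induced
   norm. *)
Definition asplund (R : realType) (X : completeNormedModType R) :=
  forall V : submodClosed X,
    separable (subspace_of V) -> separable (dual (subspace_of V)).

(** * Sets and set-valued mappings *)

(* A set-valued mapping from [T] to [U] is a function [T -> set U]; balls of
   [X * Y] below are those of the maximum norm, which is the library norm. *)
Definition gph (T U : Type) (F : T -> set U) : set (T * U) :=
  [set z | F z.1 z.2].

Definition minkowski_sum (V : zmodType) (A B : set V) : set V :=
  [set a + b | a in A & b in B].

Definition L_minus (T : Type) (L : T -> set T) (y : T) : set T :=
  L y `|` [set y].

Definition Xi_delta (R : realType) (Y : normedModType R) (L : Y -> set Y)
    (ybar : Y) (delta : R) : set (set Y) :=
  [set closure (L y) | y in L_minus L ybar `&` ball ybar delta].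

Section Distance.
Context (R : realType) (Z : normedModType R).

Definition dist_set (z : Z) (S : set Z) : \bar R :=
  ereal_inf [set (`|u - z|)%:E | u in S].

End Distance.

(** * Normal cones and coderivatives *)

Section Cones.
Context (R : realType).

(* If [zbar] is isolated in [S] then the limsup is [-oo] and every functional
   is normal. *)
Definition frechet_normal (Z : normedModType R) (S : set Z) (zbar : Z) :
    set (dual Z) :=
  [set zs | S zbar /\
    (limf_esup (fun z => (zs (z - zbar) / `|z - zbar|)%:E)
       (within S zbar^') <= 0)%E].

(* As usual in variational analysis, [t_k] decreasing to [0] means [t_k > 0] and
   [t_k --> 0]; monotonicity is not required. *)
Definition clarke_tangent (Z : normedModType R) (S : set Z) (zbar : Z) :
    set Z :=
  [set w | forall (z : nat -> Z) (t : nat -> R),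
    (forall k, S (z k)) -> z @ \oo --> zbar ->
    (forall k, 0 < t k) -> t @ \oo --> (0 : R) ->
    exists2 wk : nat -> Z, wk @ \oo --> w & forall k, S (z k + t k *: wk k)].

Definition clarke_normal (Z : normedModType R) (S : set Z) (zbar : Z) :
    set (dual Z) :=
  [set zs | S zbar /\ forall w, clarke_tangent S zbar w -> zs w <= 0].

Definition coderivative
    (N : forall Z : normedModType R, set Z -> Z -> set (dual Z))
    (X Y : normedModType R) (F : X -> set Y) (x : X) (y : Y) (ys : dual Y) :
    set (dual X) :=
  [set xs | N _ (gph F) (x, y) (dual_pair xs (- ys))].

Definition clarke_coderivative := coderivative clarke_normal.
Definition frechet_coderivative := coderivative frechet_normal.

Definition qualification
    (N : forall Z : normedModType R, set Z -> Z -> set (dual Z))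
    (X Y : normedModType R) (F : X -> set Y) (Omega : set X)
    (xbar : X) (ybar : Y) :=
  exists2 eps : R, 0 < eps &
    forall (x1 : X) (y1 : Y) (x2 : X) (xs1 xs2 : dual X),
      (gph F `&` ball (xbar, ybar) eps) (x1, y1) ->
      (Omega `&` ball xbar eps) x2 ->
      (\bigcup_(ys in ball (0 : dual Y) eps)
         coderivative N F x1 y1 ys) xs1 ->
      N _ Omega x2 xs2 ->
      `|xs1| + `|xs2| = 1 ->
      eps <= `|xs1 + xs2|.

Definition QC_C := qualification clarke_normal.
Definition QC_F := qualification frechet_normal.

End Cones.

(** * Approximate stationarity *)

Section Stationarity.
Context (R : realType).

Definition approx_stationary (Z : normedModType R) (n : nat)
    (Xi : 'I_n -> set (set Z)) (zbar : Z) :=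
  forall eps : R, 0 < eps ->
    exists (rho : R) (A : 'I_n -> set Z) (z : 'I_n -> Z),
      [/\ 0 < rho < eps,
          forall i, Xi i (A i),
          forall i, ball zbar eps (z i),
          (\big[maxe/-oo]_(i < n) dist_set (z i) (A i) < (eps * rho)%:E)%E &
          \bigcap_i [set a - z i | a in A i] `&` ball 0 rho = set0].

Definition triple_approx_stationary (X Y : normedModType R)
    (F : X -> set Y) (Omega : set X) (Xi : set (set Y))
    (xbar : X) (ybar : Y) :=
  @approx_stationary (X * Y)%type 2
    (fun i => if i == ord0 then [set gph F]
              else [set Omega `*` A | A in Xi])
    (xbar, ybar).

End Stationarity.

(* Main.v *)
Require Import Defs.
From HB Require Import structures.
From mathcomp Require Import all_boot all_order all_algebra.
From mathcomp Require Import all_classical all_reals all_analysis.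
From mathcomp Require Import ring lra.

Set Implicit Arguments.
Unset Strict Implicit.
Unset Printing Implicit Defensive.

Import Order.TTheory GRing.Theory Num.Theory.
Import numFieldTopology.Exports numFieldNormedType.Exports.

Local Open Scope classical_set_scope.
Local Open Scope ring_scope.

(** Approximate stationarity yields points at which [|(u1 - z1) - (u2 - z2)|] is
    small on [gph F * (Omega * A)] but never zero nearby. A variational principle
    turns them into an exact local minimiser of this function plus a small convex
    perturbation, and a normal to the product set that is almost a subgradient of
    the norm splits into normals of norm about one with almost zero sum; the
    qualification condition then keeps the [Y]-component away from zero.

    For the Clarke cone the normal comes from Hahn-Banach, because the Clarke
    tangent cone is convex. In Asplund spaces the problem is first restricted to a
    separable subspace [V]. Its dual is separable, so convex Lipschitz functions on
    [V] are uniform limits of smooth ones, and a smooth variational principle gives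
    a Frechet normal relative to [V]. By Hahn-Banach, the existence of a suitable
    Frechet normal amounts to inequalities on finite families of points, and [V] is
    chosen to contain a violating family whenever there is one; hence the normal
    relative to [V] yields one in the whole space. *)

(** * Convex separation *)

(** Smoothing is only uniform: it controls the values of a convex function, not its slopes. Hence
    every approximate subgradient inequality [f h <= phi (u + h) - phi u + kappa |h| + eta] carries
    an additive [eta], which is useless for small [h]. It does no harm because |(u1 - z1) - (u2 -
    z2)| is tested in two directions only. It is constant along (t, t), so [h] can be scaled up
    until [eta] is negligible. In the direction that brings it to zero, the step is as long as the
    current value, which is at least half the value at the minimiser, and [eta] is chosen as a small
    fraction of that. Exact Clarke subgradients satisfy the same inequality, so one argument,
    parametrised by the cone [N], serves both cases.

    In [separated_normals] one [kappa] is the Lipschitz constant of the convex perturbation, one is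
    the slope error of the normal and one pays for [eta]; this gives the bounds [2 * kappa] and
    [1 - 3 * kappa]. *)

Section HahnBanach.
Context (R : realType) (E : lmodType R).

Definition sublinear (q : E -> R) :=
  (forall x y, q (x + y) <= q x + q y) /\
  (forall t x, 0 < t -> q (t *: x) <= t * q x).

Lemma sublinearZ q t x : sublinear q -> 0 < t -> q (t *: x) = t * q x.
Proof.
move=> [_ qZ] t0; apply/eqP; rewrite eq_le qZ//=.
have ti0 : 0 < t^-1 by rewrite invr_gt0.
have := qZ _ (t *: x) ti0; rewrite scalerA mulVf ?gt_eqF// scale1r.
by rewrite -(ler_pM2l t0) mulrA mulfV ?gt_eqF// mul1r.
Qed.

Lemma sublinear0 q : sublinear q -> q 0 = 0.
Proof.
move=> qs; have := sublinearZ 0 qs (ltr0n R 2); rewrite scaler0 => h; lra.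
Qed.

Lemma sublinearN q x : sublinear q -> - q (- x) <= q x.
Proof.
move=> qs; have := qs.1 x (- x); rewrite subrr (sublinear0 qs) => h; lra.
Qed.

(** The pointwise infimum is finite, as [q x >= - q (- x) >= - p (- x)]. It is subadditive because
    any two members are comparable: the smaller one serves at both points. *)
Lemma sublinear_chain_inf (A : set (E -> R)) p :
  A !=set0 -> (forall q, A q -> sublinear q) ->
  (forall q q', A q -> A q' -> (forall x, q x <= q' x) \/ (forall x, q' x <= q x)) ->
  (forall q x, A q -> q x <= p x) ->
  exists g, [/\ sublinear g, forall x, g x <= p x & forall q x, A q -> g x <= q x].
Proof.
move=> [q0 Aq0] As Ach Ap.
pose B x := [set q x | q in A].
have Bn x : B x !=set0 by exists (q0 x), q0.
have Bl x : has_lbound (B x).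
  exists (- p (- x)) => _ [q Aq <-].
  by rewrite (le_trans _ (sublinearN _ (As _ Aq)))// lerN2 Ap.
pose g x := inf (B x).
have gle q x : A q -> g x <= q x by move=> Aq; apply: ge_inf => //; exists q.
exists g; split=> [||//]; last by move=> x; exact: le_trans (gle _ _ Aq0) (Ap _ _ Aq0).
split=> [x y|t x t0].
- rewrite -lerBlDr; apply: lb_le_inf => // _ [q Aq <-].
  rewrite lerBlDr -lerBlDl; apply: lb_le_inf => // _ [q' Aq' <-].
  rewrite lerBlDr; case: (Ach _ _ Aq Aq') => qq.
    have := (As _ Aq).1 x y; have := qq y; have := gle _ (x + y) Aq; lra.
  have := (As _ Aq').1 x y; have := qq x; have := gle _ (x + y) Aq'; lra.
- rewrite mulrC -ler_pdivrMr//; apply: lb_le_inf => // _ [q Aq <-].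
  rewrite ler_pdivrMr// mulrC -(sublinearZ _ (As _ Aq))//; exact: gle.
Qed.

(* A minimal sublinear function [m] is linear: minimality against
   [x |-> inf_{t >= 0} m (x + t y) - t m y] gives [m x + m y <= m (x + y)]. *)
Lemma sublinear_min_linear (m : E -> R) : sublinear m ->
  (forall g, sublinear g -> (forall x, g x <= m x) -> g = m) ->
  forall a x y, m (a *: x + y) = a * m x + m y.
Proof.
move=> ms mmin.
have mD x y : m (x + y) = m x + m y.
  apply/eqP; rewrite eq_le ms.1/=.
  pose B x := [set m (x + t *: y) - t * m y | t in [set t | 0 <= t]].
  have Bn z : B z !=set0 by exists (m (z + 0 *: y) - 0 * m y), 0 => //=.
  have Bl z : has_lbound (B z).
    exists (- m (- z)) => _ [t /= t0 <-].
    have -> : t * m y = m (t *: y).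
      move: t0; rewrite le_eqVlt => /predU1P[<-|t0].
        by rewrite scale0r mul0r (sublinear0 ms).
      by rewrite (sublinearZ _ ms).
    have := ms.1 (z + t *: y) (- z).
    rewrite addrAC subrr add0r => h; lra.
  pose g z := inf (B z).
  have gle z t : 0 <= t -> g z <= m (z + t *: y) - t * m y.
    by move=> t0; apply: ge_inf => //; exists t.
  have gm z : g z <= m z by have := gle z 0 (lexx _); rewrite scale0r addr0 mul0r subr0.
  have gs : sublinear g.
    split=> [u v|s u s0].
    - rewrite -lerBlDr; apply: lb_le_inf => // _ [t /= t0 <-].
      rewrite lerBlDr -lerBlDl; apply: lb_le_inf => // _ [t' /= t'0 <-].
      rewrite lerBlDr; have := gle (u + v) (t + t') (addr_ge0 t0 t'0).
      have := ms.1 (u + t *: y) (v + t' *: y).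
      rewrite scalerDl (addrACA u) => h1 h2.
      have : g (u + v) <= m (u + t *: y) + m (v + t' *: y) - (t + t') * m y by lra.
      rewrite mulrDl => h3; lra.
    - rewrite mulrC -ler_pdivrMr//; apply: lb_le_inf => // _ [t /= t0 <-].
      rewrite ler_pdivrMr// mulrC.
      have := gle (s *: u) (s * t) (mulr_ge0 (ltW s0) t0).
      by rewrite -scalerA -scalerDr (sublinearZ _ ms)// -mulrA -mulrBr.
  have := gle x 1 ler01; rewrite (mmin _ gs gm) scale1r mul1r => h; lra.
have mN x : m (- x) = - m x.
  by have := mD x (- x); rewrite subrr (sublinear0 ms) => h; lra.
move=> a x y; rewrite mD; congr (_ + _).
have [a0|a0|->] := ltgtP a 0; last by rewrite scale0r mul0r (sublinear0 ms).
  by rewrite -[a]opprK scaleNr mN (sublinearZ _ ms) ?oppr_gt0//; lra.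
by rewrite (sublinearZ _ ms).
Qed.

(** Zorn's lemma for the reversed pointwise order on sublinear functions below [p]; its maximal
    elements are the minimal sublinear functions, hence linear. Constraints on [f] beyond [f <= p]
    are later encoded in the choice of [p]. *)
Theorem hahn_banach (p : E -> R) : sublinear p ->
  exists2 f : E -> R, (forall a x y, f (a *: x + y) = a * f x + f y) &
    forall x, f x <= p x.
Proof.
move=> ps.
pose T := {q : E -> R | sublinear q /\ forall x, q x <= p x}.
pose r (s t : T) := `[< forall x, sval t x <= sval s x >].
have [||s t|A tA|[m [ms mp]] mmin] := @Zorn T r.
- by move=> t; apply/asboolP.
- move=> s t u /asboolP st /asboolP tu; apply/asboolP => x.
  exact: le_trans (tu x) (st x).
- case: s t => [s sP] [t tP] /asboolP /= st /asboolP /= ts.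
  have e : s = t by apply/funext => x; apply/eqP; rewrite eq_le st ts.
  by subst t; congr exist; exact: Prop_irrelevance.
- have [A0|/set0P A0] := eqVneq A set0.
    by exists (exist _ p (conj ps (fun=> lexx _))) => s; rewrite A0.
  have [|||q x [s As <-]|g [gs gp gA]] := @sublinear_chain_inf [set sval s | s in A] p.
  + by case: A0 => s As; exists (sval s), s.
  + by move=> _ [s As <-]; exact: (svalP s).1.
  + move=> _ _ [s As <-] [t At <-].
    by have [/asboolP|/asboolP] := tA s t As At; [right|left].
  + exact: (svalP s).2.
  exists (exist _ g (conj gs gp)) => s As; apply/asboolP => x /=.
  by apply: gA; exists s.
- exists m => //; apply: sublinear_min_linear => // g gs gm.
  have gp x : g x <= p x by exact: le_trans (gm x) (mp x).
  have := mmin (exist _ g (conj gs gp)).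
  by move=> /(_ (introT (asboolP _) gm)) /(congr1 sval).
Qed.

End HahnBanach.

Definition convex_on (R : realType) (E : lmodType R) (f : E -> R) :=
  forall t x y, 0 <= t <= 1 -> f (t *: x + (1 - t) *: y) <= t * f x + (1 - t) * f y.

Definition lipschitz_fun (R : realType) (E : normedModType R) (C : R) (f : E -> R) :=
  forall x y, f x <= f y + C * `|x - y|.

Section Sandwich.
Context (R : realType) (E : normedModType R).

Lemma dual_of_bounded (f : E -> R) C :
  (forall a x y, f (a *: x + y) = a * f x + f y) -> (forall x, f x <= C * `|x|) ->
  exists g : dual E, forall x, g x = f x.
Proof.
move=> fl fC.
have fP : (f : E -> R^o) \in @dual_pred R E.
  apply/dual_predP; split; first by move=> a u v; rewrite fl.
  pose h : {linear E -> R^o} := HB.pack (f : E -> R^o)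
    (GRing.isLinear.Build R E R^o *:%R f (fun a u v => fl a u v)).
  have f0 : f 0 = 0 by exact: (linear0 h).
  have fN x : f (- x) = - f x by exact: (linearN h).
  have fB : bounded_near h (nbhs (0 : E)).
    apply/bounded_funP => r; exists (`|C| * `|r|) => x xr.
    have Cx y : `|y| <= r -> f y <= `|C| * `|r|.
      move=> yr; rewrite (le_trans (fC _))// (le_trans (ler_wpM2r _ (ler_norm _)))//.
      by rewrite ler_wpM2l// (le_trans yr)// ler_norm.
    by rewrite ler_norml lerNl -fN !Cx// normrN.
  exact: (@bounded_linear_continuous R E R^o h fB).
by exists (Dual fP).
Qed.

(* The separating functional is found below
   [x |-> inf {t * psi ((x + y) / t) + r | t > 0, (y, r) in P}]. *)
Lemma convex_sandwich (psi : E -> R) (C : R) (P : set (E * R)) :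
  convex_on psi -> lipschitz_fun C psi ->
  P (0, 0) -> (forall a b, P a -> P b -> P (a.1 + b.1, a.2 + b.2)) ->
  (forall t a, 0 < t -> P a -> P (t *: a.1, t * a.2)) ->
  (forall a, P a -> 0 <= psi a.1 + a.2) ->
  exists2 f : dual E, (forall x, f x <= psi x) & (forall a, P a -> f (- a.1) <= a.2).
Proof.
move=> psic psiL P0 PD PZ Ppsi.
pose B x := [set s | exists t a, [/\ 0 < t, P a & s = t * psi (t^-1 *: (x + a.1)) + a.2]].
have Bn x : B x !=set0.
  by exists (1 * psi (1^-1 *: (x + 0)) + 0), 1, (0, 0).
have Blb x : lbound (B x) (- C * `|x|).
  move=> _ [t [a [t0 Pa ->]]].
  have ti0 : 0 < t^-1 by rewrite invr_gt0.
  have := psiL (t^-1 *: a.1) (t^-1 *: (x + a.1)).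
  rewrite -scalerBr normrZ opprD addrCA subrr addr0 normrN gtr0_norm// => h1.
  have := Ppsi _ (PZ _ _ ti0 Pa) => /= h2.
  have : 0 <= psi (t^-1 *: (x + a.1)) + C * (t^-1 * `|x|) + t^-1 * a.2 by lra.
  rewrite -(pmulr_rge0 _ t0).
  set u := psi _; have -> : t * (u + C * (t^-1 * `|x|) + t^-1 * a.2) = t * u + a.2 + C * `|x|.
    by field; rewrite gt_eqF.
  lra.
have Bl x : has_lbound (B x) by exists (- C * `|x|); exact: Blb.
pose p x := inf (B x).
have ple x t a : 0 < t -> P a -> p x <= t * psi (t^-1 *: (x + a.1)) + a.2.
  by move=> t0 Pa; apply: ge_inf => //; exists t, a.
have ps : sublinear p.
  split=> [x y|s x s0].
  - rewrite -lerBlDr; apply: lb_le_inf => // _ [t [a [t0 Pa ->]]].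
    rewrite lerBlDr -lerBlDl; apply: lb_le_inf => // _ [t' [a' [t'0 Pa' ->]]].
    have t20 : 0 < t + t' by exact: addr_gt0.
    rewrite lerBlDr; apply: (le_trans (ple _ (t + t') (a.1 + a'.1, a.2 + a'.2) t20 (PD _ _ Pa Pa'))) => /=.
    set u := t^-1 *: _; set v := t'^-1 *: _.
    have t01 : 0 <= t / (t + t') <= 1.
      by rewrite ler_pdivrMr// mul1r lerDl (ltW t'0) andbT divr_ge0// ltW.
    have := psic _ u v t01.
    have e1 : 1 - t / (t + t') = t' / (t + t') by field; rewrite gt_eqF.
    rewrite e1 /u /v !scalerA.
    have -> : t / (t + t') / t = (t + t')^-1 by field; rewrite !gt_eqF.
    have -> : t' / (t + t') / t' = (t + t')^-1 by field; rewrite !gt_eqF.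
    rewrite -scalerDr addrACA -/u -/v -(ler_pM2l t20) mulrDr.
    set w := psi (_ *: (x + y + _)).
    have -> : (t + t') * (t / (t + t') * psi u) = t * psi u by field; rewrite gt_eqF.
    have -> : (t + t') * (t' / (t + t') * psi v) = t' * psi v by field; rewrite gt_eqF.
    by rewrite /w => h; lra.
  - rewrite mulrC -ler_pdivrMr//; apply: lb_le_inf => // _ [t [a [t0 Pa ->]]].
    rewrite ler_pdivrMr//.
    apply: (le_trans (ple _ (s * t) (s *: a.1, s * a.2) (mulr_gt0 s0 t0) (PZ _ _ s0 Pa))) => /=.
    rewrite -scalerDr scalerA; have -> : (s * t)^-1 * s = t^-1 by field; rewrite !gt_eqF.
    by rewrite le_eqVlt; apply/orP; left; apply/eqP; ring.
have [f fl fp] := hahn_banach ps.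
have fpsi x : f x <= psi x.
  by have := ple x 1 (0, 0) ltr01 P0; rewrite /= invr1 scale1r addr0 mul1r addr0; exact: le_trans.
(* In [t * psi (t^-1 *: x) <= t * psi 0 + C |x|] the first term vanishes as [t] tends to 0, so a
   positive [psi 0] does not enter the bound. *)
have pC x : p x <= C * `|x|.
  rewrite -(addr0 (C * _)); apply/ler_addgt0Pr => e e0; rewrite addr0.
  have [t0|t0] := ltP 0 (psi 0).
    have s0 : 0 < e / psi 0 by exact: divr_gt0.
    have := ple x (e / psi 0) (0, 0) s0 P0; rewrite /= !addr0.
    move/le_trans; apply.
    have := psiL ((e / psi 0)^-1 *: x) 0.
    rewrite subr0 normrZ gtr0_norm ?invr_gt0// -(ler_pM2l s0) mulrDr.
    move/le_trans; apply.
    by rewrite le_eqVlt; apply/orP; left; apply/eqP; field; rewrite !gt_eqF.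
  have := ple x 1 (0, 0) ltr01 P0; rewrite /= invr1 scale1r !addr0 mul1r.
  have := psiL x 0; rewrite subr0; lra.
have [g gE] := dual_of_bounded fl (fun x => le_trans (fp x) (pC x)).
exists g => [x|a Pa]; first by rewrite gE.
rewrite gE (le_trans (fp _))//.
apply/ler_addgt0Pr => e e0.
have psi00 : 0 <= psi 0 by have := Ppsi _ P0; rewrite addr0.
have s0 : 0 < e / (psi 0 + 1) by rewrite divr_gt0// ltr_pwDr.
have := ple (- a.1) _ a s0 Pa; rewrite addNr scaler0 => /le_trans; apply.
rewrite addrC lerD2l -mulrA ger_pMr// mulrC ler_pdivrMr ?ltr_pwDr//; lra.
Qed.

Lemma subgradient (phi : E -> R) (C : R) w :
  convex_on phi -> lipschitz_fun C phi ->
  exists f : dual E, forall h, f h <= phi (w + h) - phi w.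
Proof.
move=> phic phiL.
have [|x y|||||f fle _] :=
  @convex_sandwich (fun h => phi (w + h) - phi w) C [set (0, 0)].
- move=> t x y t01; have := phic t (w + x) (w + y) t01.
  rewrite !scalerDr addrACA -scalerDl subrKC scale1r => h; lra.
- have := phiL (w + x) (w + y); rewrite opprD addrACA subrr add0r => h; lra.
- by [].
- by move=> _ _ -> ->; rewrite /= !addr0.
- by move=> t _ _ ->; rewrite /= scaler0 mulr0.
- by move=> _ ->; rewrite /= !addr0 subrr.
- by exists f.
Qed.

End Sandwich.

(** * Variational principles *)

Section ConvexCalculus.
Context (R : realType) (E : lmodType R).

Lemma convex_onD (f g : E -> R) : convex_on f -> convex_on g ->
  convex_on (fun x => f x + g x).
Proof. by move=> fc gc t x y t01; have := fc _ x y t01; have := gc _ x y t01; lra. Qed.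

Lemma convex_onZ a (f : E -> R) : 0 <= a -> convex_on f -> convex_on (fun x => a * f x).
Proof.
move=> a0 fc t x y t01; have := ler_wpM2l a0 (fc _ x y t01); lra.
Qed.

Lemma convex_on_shift (f : E -> R) u : convex_on f -> convex_on (fun x => f (x - u)).
Proof.
move=> fc t x y t01; have := fc t (x - u) (y - u) t01.
rewrite !scalerBr addrACA -opprD -scalerDl subrKC scale1r //.
Qed.

End ConvexCalculus.

Section Sequences.
Context (R : realType).

Lemma geo_small (a e : R) : 0 < e -> exists n, forall m, (n <= m)%N -> a / 2 ^+ m < e.
Proof.
move=> e0; have [n an] : exists n : nat, a / e < n%:R.
  exists (Num.bound `|a / e|); rewrite (le_lt_trans (ler_norm _))//.
  exact: archi_boundP.
exists n => m nm; rewrite ltr_pdivrMr ?exprn_gt0// mulrC -ltr_pdivrMr//.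
rewrite (lt_le_trans an)// -natrX ler_nat (leq_trans nm)//.
by apply: ltnW; rewrite ltn_expl.
Qed.

Lemma half_pow (K : R) n : K / 2 ^+ n = K / 2 ^+ n.+1 + K / 2 ^+ n.+1.
Proof. by rewrite exprS; field; rewrite expf_neq0. Qed.

Lemma geo_cauchy (V : normedModType R) (u : nat -> V) (K : R) :
  (forall n, `|u n.+1 - u n| <= K / 2 ^+ n) ->
  forall n k, `|u (n + k)%N - u n| <= 2 * K / 2 ^+ n - 2 * K / 2 ^+ (n + k).
Proof.
move=> uK n; elim=> [|k IH]; first by rewrite addn0 !subrr normr0.
rewrite addnS -(subrKA (u (n + k)%N)) (le_trans (ler_normD _ _))//.
have := uK (n + k)%N; have := half_pow K (n + k); have := half_pow (2 * K) (n + k).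
have -> : 2 * K / 2 ^+ (n + k) = K / 2 ^+ (n + k) + K / 2 ^+ (n + k) by ring.
lra.
Qed.

Definition cauchy_seq (V : normedModType R) (u : nat -> V) :=
  forall e : R, 0 < e -> exists n, forall i j, (n <= i)%N -> (n <= j)%N -> `|u i - u j| < e.

(** Completeness is attached to the set, so that it also applies to the trace of [S] on a subspace
    type that is only a normed module. *)
Definition seq_complete (V : normedModType R) (S : set V) :=
  forall u : nat -> V, (forall n, S (u n)) -> cauchy_seq u ->
    exists2 l, S l & u @ \oo --> l.

Lemma geo_cauchy_seq (V : normedModType R) (u : nat -> V) (K : R) :
  (forall n, `|u n.+1 - u n| <= K / 2 ^+ n) -> cauchy_seq u.
Proof.
move=> uK e e0.
have K0 : 0 <= K by have := uK 0%N; rewrite expr0 divr1; exact: le_trans.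
have [n nP] := geo_small (2 * K) (divr_gt0 e0 (ltr0n R 2)).
have H i : (n <= i)%N -> `|u i - u n| < e / 2.
  move=> ni; have := geo_cauchy uK n (i - n); rewrite subnKC//.
  have := nP n (leqnn _).
  have : 0 <= 2 * K / 2 ^+ i by rewrite divr_ge0 ?mulr_ge0// exprn_ge0.
  lra.
exists n => i j ni nj; rewrite -(subrKA (u n)) (le_lt_trans (ler_normD _ _))//.
have := H i ni; have := H j nj; rewrite (distrC (u n)); lra.
Qed.

Lemma geo_limit (V : normedModType R) (u : nat -> V) (K : R) l :
  (forall n, `|u n.+1 - u n| <= K / 2 ^+ n) -> u @ \oo --> l ->
  forall n, `|l - u n| <= 2 * K / 2 ^+ n.
Proof.
move=> uK ul n.
have K0 : 0 <= K by have := uK 0%N; rewrite expr0 divr1; exact: le_trans.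
apply/ler_addgt0Pr => e e0.
have /cvgrPdist_lt/(_ e e0)[N _ NP] := ul.
have := NP (n + N)%N (leq_addl _ _) => /= h.
rewrite -(subrKA (u (n + N)%N)) (le_trans (ler_normD _ _))//.
have := geo_cauchy uK n N.
have : 0 <= 2 * K / 2 ^+ (n + N) by rewrite divr_ge0 ?mulr_ge0// exprn_ge0.
lra.
Qed.

Lemma seq_complete_setT (V : completeNormedModType R) : seq_complete [set: V].
Proof.
move=> u _ uc; suff /cauchy_cvgP uC : cauchy (u @ \oo) by exists (lim (u @ \oo)).
apply: cauchy_exP => e e0.
have [n nP] := uc e e0.
by exists (u n); exists n => // i ni; rewrite -ball_normE /=; exact: nP.
Qed.

Lemma closed_seq_complete (V : normedModType R) (S : set V) :
  seq_complete [set: V] -> closed S -> seq_complete S.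
Proof.
move=> Vc Scl u uS uc; have [l _ ul] := Vc u (fun=> I) uc.
exists l => //; apply: (closed_cvg S Scl _ _ ul).
by apply: nearW => n; exact: uS.
Qed.

Lemma norm_fst_snd (V W : normedModType R) (z : V * W) : `|z.1| <= `|z| /\ `|z.2| <= `|z|.
Proof. by rewrite prod_normE /= !le_max !lexx orbT. Qed.

Lemma seq_complete_prod (V W : normedModType R) (S : set V) (T : set W) :
  seq_complete S -> seq_complete T -> seq_complete (S `*` T).
Proof.
move=> Sc Tc u uST uc.
have [|l1 Sl1 ul1] := Sc (fun n => (u n).1) (fun n => (uST n).1).
  move=> e /uc[n nP]; exists n => i j ni nj.
  exact: le_lt_trans (norm_fst_snd (u i - u j)).1 (nP _ _ ni nj).
have [|l2 Tl2 ul2] := Tc (fun n => (u n).2) (fun n => (uST n).2).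
  move=> e /uc[n nP]; exists n => i j ni nj.
  exact: le_lt_trans (norm_fst_snd (u i - u j)).2 (nP _ _ ni nj).
exists (l1, l2); first by split.
have -> : u = (fun n => ((u n).1, (u n).2)) by apply/funext => n; case: (u n).
exact: cvg_pair ul1 ul2.
Qed.

End Sequences.

(* For convex functions this is Frechet differentiability everywhere, in a form that
   does not mention the derivative and passes to limits of series. *)
Definition smooth (R : realType) (W : normedModType R) (f : W -> R) :=
  forall x (e : R), 0 < e -> exists2 d : R, 0 < d &
    forall h, `|h| < d -> f (x + h) + f (x - h) - 2 * f x <= e * `|h|.

Section Smooth.
Context (R : realType) (W : normedModType R).

Lemma smoothD (f g : W -> R) : smooth f -> smooth g -> smooth (fun x => f x + g x).
Proof.
move=> fs gs x e e0; have e20 : 0 < e / 2 by rewrite divr_gt0.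
have [d d0 dP] := fs x _ e20; have [d' d'0 d'P] := gs x _ e20.
exists (Num.min d d'); first by rewrite lt_min d0.
move=> h; rewrite lt_min => /andP[/dP h1 /d'P h2].
by move: h1 h2; set n := `|h|; lra.
Qed.

Lemma smoothZ a (f : W -> R) : 0 < a -> smooth f -> smooth (fun x => a * f x).
Proof.
move=> a0 fs x e e0; have [d d0 dP] := fs x _ (divr_gt0 e0 a0).
exists d => // h /dP; rewrite -(ler_pM2l a0) => h1.
have : a * (e / a * `|h|) = e * `|h| by field; rewrite gt_eqF.
lra.
Qed.

Lemma smooth_shift (f : W -> R) u : smooth f -> smooth (fun x => f (x - u)).
Proof.
move=> fs x e e0; have [d d0 dP] := fs (x - u) _ e0.
by exists d => // h /dP; rewrite (addrAC x h) (addrAC x (- h)).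
Qed.

End Smooth.

Section Variational.
Context (R : realType) (W : normedModType R).

Lemma norm_convex : convex_on (fun x : W => `|x|).
Proof.
move=> t x y /andP[t0 t1]; rewrite (le_trans (ler_normD _ _))// !normrZ.
by rewrite !ger0_norm// subr_ge0.
Qed.

Lemma norm_lipschitz : lipschitz_fun 1 (fun x : W => `|x|).
Proof. by move=> x y; rewrite mul1r -{1}(subrKC y x) ler_normD. Qed.

Lemma near_min (T : set W) (f : W -> R) (e m : R) : T !=set0 -> 0 < e ->
  (forall s, T s -> m <= f s) -> exists2 u, T u & forall s, T s -> f u <= f s + e.
Proof.
move=> [t Tt] e0 fm.
have hi : has_inf [set f s | s in T].
  by split; [exists (f t), t|exists m => _ [s Ts <-]; exact: fm].
have [_ [u Tu <-] ue] := inf_adherent e0 hi.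
exists u => // s Ts; rewrite (le_trans (ltW ue))// lerD2r.
by apply: ge_inf; [exact: hi.2|exists s].
Qed.

(* With [theta c = |.|] this is Ekeland's principle with a convex perturbation;
   with smooth [theta c] close to the norm, the perturbation is smooth as in the
   Borwein-Preiss principle. *)
Lemma variational_principle (phi : W -> R) (C : R) (S : set W) (ubar : W)
    (kappa r : R) (theta : R -> W -> R) :
  lipschitz_fun C phi -> seq_complete S -> S ubar -> 0 < kappa -> 0 < r ->
  (forall s, S s -> `|s - ubar| <= r -> phi ubar <= phi s + kappa * r / 64) ->
  (forall c, 0 < c -> convex_on (theta c)) ->
  (forall c, 0 < c -> lipschitz_fun 1 (theta c)) ->
  (forall c x, 0 < c -> `|x| - c <= theta c x <= `|x| + c) ->
  exists (G : W -> R) (v : W),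
    [/\ convex_on G, lipschitz_fun kappa G, S v, `|v - ubar| < r &
     (forall s, S s -> `|s - ubar| <= r -> phi v + G v <= phi s + G s) /\
     ((forall c, 0 < c -> smooth (theta c)) -> smooth G)].
Proof.
move=> phiL Sc Su k0 r0 phimin thc thL thn.
pose T := [set s | S s /\ `|s - ubar| <= r].
have Tu : T ubar by split; rewrite // subrr normr0 ltW.
have ex (p : R * (W -> R)) : exists u, 0 < p.1 ->
    (exists m, forall s, T s -> m <= p.2 s) ->
    T u /\ forall s, T s -> p.2 u <= p.2 s + p.1.
  have [p0|p0] := ltP 0 p.1; last by exists ubar.
  have [[m mP]|nm] := pselect (exists m, forall s, T s -> m <= p.2 s); last by exists ubar.
  by have [|u Tv uP] := near_min _ p0 mP; [exists ubar|exists u].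
have [pick pickP] := choice ex.
(* The weights [lam] sum to [kappa], and [eps 0] is the error allowed at [ubar]. As
   [lam j * c j = eps j / 2] and [lam j * (r / 8 / 2 ^+ j) = 4 * eps j], consecutive points differ
   by at most [r / 8 / 2 ^+ j], and the limit stays within [r / 4] of [ubar]. *)
pose lam j : R := kappa / 2 ^+ j.+1.
pose eps j : R := kappa * r / 64 / 2 ^+ j / 2 ^+ j.
pose c j : R := r / 64 / 2 ^+ j.
have p20 j : (0 : R) < 2 ^+ j by rewrite exprn_gt0.
have lam0 j : 0 < lam j by rewrite divr_gt0.
have eps0 j : 0 < eps j by rewrite !divr_gt0// mulr_gt0.
have c0 j : 0 < c j by rewrite !divr_gt0.
pose step j (s : (W -> R) * W) : (W -> R) * W :=
  let g := fun x => s.1 x + lam j * theta (c j) (x - s.2) in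
  (g, pick (eps j.+1, fun x => phi x + g x)).
pose st := fix st j := if j is j'.+1 then step j' (st j') else (fun=> 0, ubar).
pose g j := (st j).1; pose u j := (st j).2.
have gS j x : g j.+1 x = g j x + lam j * theta (c j) (x - u j) by [].
have uS j : u j.+1 = pick (eps j.+1, fun x => phi x + g j.+1 x) by [].
have gc j : convex_on (g j).
  elim: j => [|j IH]; first by move=> t x y _; rewrite !mulr0 addr0.
  apply: convex_onD => //; apply: convex_onZ; first exact: ltW.
  exact/convex_on_shift/thc.
have lamS j : kappa / 2 ^+ j = lam j + kappa / 2 ^+ j.+1.
  by rewrite /lam -half_pow.
(* The tail is Lipschitz with the weight that remains. In the limit this makes [G - g n] Lipschitz
   with the small constant [kappa / 2 ^+ n], from which the smoothness of [G] follows. *)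
have gL n k x y : g (n + k)%N x - g n x <=
    g (n + k)%N y - g n y + (kappa / 2 ^+ n - kappa / 2 ^+ (n + k)) * `|x - y|.
  elim: k => [|k IH]; first by rewrite addn0 !subrr mul0r addr0.
  rewrite addnS !gS.
  have := thL _ (c0 (n + k)%N) (x - u (n + k)%N) (y - u (n + k)%N).
  rewrite opprD opprK addrACA addNr addr0 mul1r -(ler_pM2l (lam0 (n + k)%N)).
  have := congr1 (fun z => z * `|x - y|) (lamS (n + k)%N) => /=; rewrite mulrDl.
  move: IH; rewrite !mulrBl mulrDr; lra.
have g0 x : g 0%N x = 0 by [].
have gLk j : lipschitz_fun kappa (g j).
  move=> x y; have := gL 0%N j x y; rewrite add0n !g0 !subr0 expr0 divr1 mulrBl => h.
  have : 0 <= kappa / 2 ^+ j * `|x - y| by rewrite mulr_ge0// divr_ge0// ltW.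
  lra.
have fb j : exists m, forall s, T s -> m <= phi s + g j s.
  exists (phi ubar + g j ubar - (`|C| + kappa) * r) => s [Ss sr].
  have := phiL ubar s; have := gLk j ubar s; rewrite (distrC ubar).
  have : C * `|s - ubar| <= `|C| * r.
    by apply: le_trans (ler_wpM2r (normr_ge0 _) (ler_norm C)) _; rewrite ler_wpM2l.
  have : kappa * `|s - ubar| <= kappa * r by rewrite ler_pM2l.
  lra.
have uT j : T (u j) /\ forall s, T s -> phi (u j) + g j (u j) <= phi s + g j s + eps j.
  case: j => [|j].
    split=> [//|s [Ss sr]]; rewrite !g0 !addr0 /eps expr0 !divr1; exact: phimin.
  rewrite uS; exact: (pickP (eps j.+1, fun x => phi x + g j.+1 x) (eps0 _) (fb _)).
have ud j : `|u j.+1 - u j| <= r / 8 / 2 ^+ j.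
  have h1 := (uT j.+1).2 _ (uT j).1; have h2 := (uT j).2 _ (uT j.+1).1.
  rewrite !gS subrr in h1.
  have /andP[h3 _] := thn _ (u j.+1 - u j) (c0 j).
  have /andP[_ h4] := thn _ 0 (c0 j); rewrite normr0 add0r in h4.
  have h5 := ler_wpM2l (ltW (lam0 j)) h3; have h6 := ler_wpM2l (ltW (lam0 j)) h4.
  have h7 : eps j.+1 <= eps j.
    have -> : eps j = 4 * eps j.+1 by rewrite /eps exprS; field; rewrite gt_eqF.
    have := eps0 j.+1; lra.
  rewrite mulrBr in h5.
  have h8 : lam j * `|u j.+1 - u j| <= lam j * (r / 8 / 2 ^+ j).
    have -> : lam j * (r / 8 / 2 ^+ j) = 4 * eps j.
      by rewrite /lam /eps exprS; field; rewrite gt_eqF.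
    have e1 : lam j * c j = eps j / 2.
      by rewrite /lam /eps /c exprS; field; rewrite gt_eqF.
    rewrite e1 in h5 h6; have := eps0 j; lra.
  by rewrite -(ler_pM2l (lam0 j)).
have ucau := geo_cauchy_seq ud.
have [v Sv uv] := Sc u (fun j => (uT j).1.1) ucau.
have vu := geo_limit ud uv.
have vubar : `|v - ubar| <= r / 4.
  by have := vu 0%N; rewrite expr0 divr1 => h; rewrite (le_trans h)//; lra.
have gx x j : `|g j.+1 x - g j x| <= kappa * (`|x - ubar| + 2 * r) / 2 ^+ j.
  rewrite gS addrAC subrr add0r normrM (gtr0_norm (lam0 j)).
  have nth : `|theta (c j) (x - u j)| <= `|x - ubar| + 2 * r.
    have /andP[h1 h2] := thn _ (x - u j) (c0 j).
    have h3 : `|x - u j| <= `|x - ubar| + r.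
      rewrite -(subrKA ubar) (le_trans (ler_normD _ _))// lerD2l distrC.
      exact: (uT j).1.2.
    have cr : c j <= r.
      rewrite /c -mulrA -invfM ler_pdivrMr ?mulr_gt0// ler_peMr ?(ltW r0)//.
      have : (1 : R) <= 2 ^+ j by rewrite exprn_ege1// ler1n.
      lra.
    have := normr_ge0 (x - u j).
    rewrite ler_norml => h4; apply/andP; split; lra.
  rewrite /lam (le_trans (ler_wpM2l _ nth)) ?(ltW (lam0 j))//.
  have b0 : 0 <= `|x - ubar| + 2 * r by rewrite addr_ge0// mulr_ge0// ltW.
  rewrite mulrAC (half_pow (kappa * _) j) lerDl divr_ge0 ?mulr_ge0 ?(ltW (p20 _))//.
  exact: ltW.
have exG x : exists G, forall j, `|G - g j x| <= 2 * (kappa * (`|x - ubar| + 2 * r)) / 2 ^+ j.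
  have [l _ xl] := @seq_complete_setT R R^o (fun j => g j x) (fun=> I) (@geo_cauchy_seq R R^o _ _ (gx x)).
  exists l; exact: (@geo_limit R R^o _ _ _ (gx x) xl).
have [G GP] := choice exG.
have Glim x e : 0 < e -> exists n, forall m, (n <= m)%N -> `|G x - g m x| < e.
  move=> e0; have [n nP] := geo_small (2 * (kappa * (`|x - ubar| + 2 * r))) e0.
  by exists n => m nm; rewrite (le_lt_trans (GP _ _))// nP.
have GL n x y : G x - g n x <= G y - g n y + kappa / 2 ^+ n * `|x - y|.
  apply/ler_addgt0Pr => e e0; have e20 : 0 < e / 2 by rewrite divr_gt0.
  have [n1 h1] := Glim x _ e20; have [n2 h2] := Glim y _ e20.
  have := gL n (n1 + n2)%N x y.
  have := h1 (n + (n1 + n2))%N; rewrite addnCA leq_addr => /(_ isT).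
  have := h2 (n + (n1 + n2))%N; rewrite addnA leq_addl => /(_ isT).
  rewrite (addnCA n1) (addnA n) !ltr_norml => /andP[a1 a2] /andP[b1 b2].
  have : 0 <= kappa / 2 ^+ (n + n1 + n2) * `|x - y| by rewrite mulr_ge0// divr_ge0// ltW.
  rewrite mulrBl; lra.
exists G, v; split => //.
- move=> t x y t01; apply/ler_addgt0Pr => e e0; have e20 : 0 < e / 4 by rewrite divr_gt0.
  have [n1 h1] := Glim x _ e20; have [n2 h2] := Glim y _ e20.
  have [n3 h3] := Glim (t *: x + (1 - t) *: y) _ e20.
  pose m := (n1 + n2 + n3)%N.
  have m1 : (n1 <= m)%N by rewrite /m -addnA leq_addr.
  have m2 : (n2 <= m)%N by rewrite /m (addnC n1) -addnA leq_addr.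
  have := h3 m (leq_addl _ _); have := h2 _ m2; have := h1 _ m1.
  rewrite !ltr_norml => /andP[d1 d2] /andP[b1 b2] /andP[a1 a2].
  have := gc m t x y t01; move: t01 => /andP[t0 t1].
  have t1' : 0 <= 1 - t by rewrite subr_ge0.
  have := ler_wpM2l t0 (ltW d1); have := ler_wpM2l t1' (ltW b1).
  move=> p1 p2 p3; lra.
- by move=> x y; have := GL 0%N x y; rewrite !g0 !subr0 expr0 divr1.
- by rewrite (le_lt_trans vubar)//; lra.
- split=> [s Ss sr|ths].
  + apply/ler_addgt0Pr => e e0.
    (* [K] collects the errors of order [1 / 2 ^+ n]: replacing [G] by [g n] at [s] and at [u n],
       moving from [v] to [u n], and [eps n]. *)
    pose K := 2 * (kappa * (`|s - ubar| + 2 * r)) + 2 * (kappa * (r + 2 * r)) +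
      (`|C| + kappa) * (2 * (r / 8)) + kappa * r / 64.
    have [n nP] := geo_small K e0.
    have := nP n (leqnn _); rewrite /K !mulrDl => KP.
    have := (uT n).2 s (conj Ss sr).
    have := GP s n; have := GP (u n) n.
    have := phiL v (u n); have := GL 0%N v (u n); rewrite !g0 !subr0 expr0 divr1.
    have := vu n => h1.
    have h2 : C * `|v - u n| <= `|C| * (2 * (r / 8)) / 2 ^+ n.
      by apply: le_trans (ler_wpM2r (normr_ge0 _) (ler_norm C)) _; rewrite -mulrA ler_wpM2l.
    have h3 : kappa * `|v - u n| <= kappa * (2 * (r / 8)) / 2 ^+ n.
      by rewrite -mulrA ler_pM2l.
    have h4 : eps n <= kappa * r / 64 / 2 ^+ n.
      rewrite /eps ler_pdivrMr// ler_peMr ?exprn_ege1 ?ler1n// ltW// divr_gt0// divr_gt0// mulr_gt0//.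
    have h5 : 2 * (kappa * (`|u n - ubar| + 2 * r)) / 2 ^+ n <= 2 * (kappa * (r + 2 * r)) / 2 ^+ n.
      rewrite ler_pM2r ?invr_gt0// ler_pM2l// ler_pM2l// lerD2r; exact: (uT n).1.2.
    rewrite !ler_norml => a1 a2 /andP[a3 a3'] /andP[a4 a4']; lra.
  + have gs n : smooth (g n).
      elim: n => [|n IH].
        move=> x e e0; exists 1 => // h _; rewrite !g0 mulr0 subr0 addr0.
        by rewrite mulr_ge0// ltW.
      apply: smoothD => //; apply: smoothZ => //; exact/smooth_shift/ths.
    move=> x e e0.
    (* The tail [G - g n] adds at most [2 * (e / 8) |h|] to the second difference, whatever the size
       of [h]; the smooth [g n] adds [e / 2 * |h|]. *)
    have [n nP] := geo_small kappa (divr_gt0 e0 (ltr0n R 8)).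
    have [d d0 dP] := gs n x _ (divr_gt0 e0 (ltr0n R 2)).
    exists d => // h /dP.
    have := GL n (x + h) x; have := GL n (x - h) x.
    have xK z : x + z - x = z by rewrite addrAC subrr add0r.
    rewrite !xK normrN.
    have : kappa / 2 ^+ n * `|h| <= e / 8 * `|h| by rewrite ler_wpM2r// ltW// nP.
    have : 0 <= e * `|h| by rewrite mulr_ge0// ltW.
    lra.
Qed.

End Variational.

(** * Smooth approximation when the dual is separable *)

Lemma dualN (R : realType) (E : normedModType R) (f : dual E) x : f (- x) = - f x.
Proof. exact: linearN. Qed.

Lemma dual_le_norm (R : realType) (E : normedModType R) (f : dual E) x :
  `|f x| <= `|f| * `|x|.
Proof.
have [->|x0] := eqVneq x 0; first by rewrite linear0 !normr0 mulr0.
have nx0 : 0 < `|x| by rewrite normr_gt0.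
have : `|f (`|x|^-1 *: x)| <= dual_norm f.
  by apply: dual_norm_ge; rewrite normrZ gtr0_norm ?invr_gt0// mulVf ?gt_eqF.
rewrite linearZ normrZ gtr0_norm ?invr_gt0//.
by rewrite ler_pdivrMl// mulrC.
Qed.

Section Smoothing.
Context (R : realType) (W : normedModType R).
Variables (fn : nat -> dual W).
Hypothesis fn_dense : forall (f : dual W) (e : R), 0 < e -> exists n, `|f - fn n| < e.
Variables (phi : W -> R) (C c : R).
Hypotheses (phic : convex_on phi) (phiL : lipschitz_fun C phi).
Hypotheses (C0 : 0 <= C) (c0 : 0 < c).

(** Completing the square with this coefficient gives [k n z >= g z - c / 2 ^+ n.+1] for every
    functional [g] bounded by [C]. These errors sum to at most [c], which bounds the loss
    [phi - psi]. *)
Let A n : R := (C + `|fn n|) ^+ 2 / (4 * (c / 2 ^+ n.+1)) + 1.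
Let k n z : R := fn n z + A n * `|z| ^+ 2.
Let val w N (y : nat -> W) : R :=
  phi (w - \sum_(i < N) y i) + \sum_(i < N) k i (y i).
(* [psi] is the infimal convolution of [phi] with all the [k n]: its conjugate adds
   to that of [phi] a weighted sum of the functions [f |-> |f - fn n| ^ 2], a
   strictly convex penalty that controls the norm because [fn] is dense. *)
Let psi w := inf [set s | exists N y, s = val w N y].

Let A0 n : 0 < A n.
Proof. by rewrite ltr_wpDl// divr_ge0 ?sqr_ge0// mulr_ge0// divr_ge0// ltW. Qed.

Let k_ge n (g : dual W) z : (forall x, g x <= C * `|x|) -> g z - c / 2 ^+ n.+1 <= k n z.
Proof.
move=> gC; have h1 := gC z.
have h2 : - (`|fn n| * `|z|) <= fn n z.
  by have := dual_le_norm (fn n) z; rewrite ler_norml => /andP[].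
rewrite /k; set b := c / _; have b0 : 0 < b by rewrite divr_gt0.
set m := C + `|fn n|; have h3 : g z - fn n z <= m * `|z| by rewrite mulrDl; lra.
have h4 : m * `|z| <= m ^+ 2 / (4 * b) * `|z| ^+ 2 + b.
  rewrite -subr_ge0; have -> : m ^+ 2 / (4 * b) * `|z| ^+ 2 + b - m * `|z| =
    (m * `|z| - 2 * b) ^+ 2 / (4 * b) by field; rewrite gt_eqF.
  by rewrite divr_ge0 ?sqr_ge0// mulr_ge0// ltW.
have h5 : A n * `|z| ^+ 2 = m ^+ 2 / (4 * b) * `|z| ^+ 2 + `|z| ^+ 2.
  by rewrite /A -/m -/b mulrDl mul1r.
have := sqr_ge0 `|z|; lra.
Qed.

Let sum_b N : \sum_(i < N) c / 2 ^+ i.+1 = c - c / 2 ^+ N.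
Proof.
elim: N => [|N IH]; first by rewrite big_ord0 expr0 divr1 subrr.
by rewrite big_ord_recr /= IH; have := half_pow c N; lra.
Qed.

(** A subgradient [g] of [phi] at [w] bounds the [phi] term below by [phi w] minus the sum of the
    [g (y i)], and [k_ge] lets the terms [k i (y i)] pay this back up to [c / 2 ^+ i.+1] each. *)
Let val_ge w N y : phi w - c <= val w N y.
Proof.
have [g gP] := subgradient w phic phiL.
have gC x : g x <= C * `|x|.
  by have := gP x; have := phiL (w + x) w; rewrite addrAC subrr add0r; lra.
have := gP (- \sum_(i < N) y i); rewrite linearN linear_sum /= => h1.
have h2 : \sum_(i < N) (g (y i) - c / 2 ^+ i.+1) <= \sum_(i < N) k i (y i).
  by apply: ler_sum => i _; exact: k_ge.
have h3 : 0 <= c / 2 ^+ N by rewrite divr_ge0 ?exprn_ge0// ltW.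
by rewrite big_split /= sumrN sum_b in h2; rewrite /val; lra.
Qed.

Let Bn w : [set s | exists N y, s = val w N y] !=set0.
Proof. by exists (val w 0 (fun=> 0)), 0%N, (fun=> 0). Qed.

Let Bl w : has_lbound [set s | exists N y, s = val w N y].
Proof. by exists (phi w - c) => _ [N [y ->]]. Qed.

Let psi_le w N y : psi w <= val w N y.
Proof. by apply: ge_inf => //; exists N, y. Qed.

(** Since [k n 0 = 0], a decomposition may be padded with zeros. Near-optimal decompositions of two
    points then get a common length that exceeds a given index [n]. *)
Let psi_adh w e : 0 < e -> exists N y, forall M, (N <= M)%N -> val w M y <= psi w + e.
Proof.
move=> e0; have [_ [N [y ->]] ve] := inf_adherent e0 (conj (Bn w) (Bl w)).
exists N, (fun i => if (i < N)%N then y i else 0) => M NM.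
rewrite (le_trans _ (ltW ve))// le_eqVlt; apply/orP; left; apply/eqP.
have k00 n : k n 0 = 0 by rewrite /k linear0 normr0 expr0n mulr0 addr0.
rewrite /val; congr (phi (w - _) + _).
- rewrite -(subnKC NM) big_split_ord /= [X in _ + X]big1 ?addr0.
    by apply: eq_bigr => i _; rewrite ltn_ord.
  by move=> i _; rewrite ltnNge leq_addr.
- rewrite -(subnKC NM) big_split_ord /= [X in _ + X]big1 ?addr0.
    by apply: eq_bigr => i _; rewrite ltn_ord.
  by move=> i _; rewrite ltnNge leq_addr.
Qed.

Let psi_adh2 w w' n e : 0 < e -> exists M y y',
  [/\ (n < M)%N, val w M y <= psi w + e & val w' M y' <= psi w' + e].
Proof.
move=> e0; have [N [y yP]] := psi_adh w e0; have [N' [y' y'P]] := psi_adh w' e0.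
exists (maxn n.+1 (maxn N N')), y, y'; split; first by rewrite leq_max leqnn.
  by apply: yP; rewrite !leq_max leqnn orbT.
by apply: y'P; rewrite !leq_max leqnn !orbT.
Qed.

(** The norm need not be uniformly convex, so the square yields a gain only in terms of the lengths
    |z| and |z'|. Lengths suffice: the slope of [k n] at [z] differs from [fn n] by at most
    [2 * A n * |z|]. *)
Let k_convex n t z z' : 0 <= t <= 1 -> k n (t *: z + (1 - t) *: z') <=
  t * k n z + (1 - t) * k n z' - t * (1 - t) * A n * (`|z| - `|z'|) ^+ 2.
Proof.
move=> t01; have h1 := norm_convex z z' t01.
rewrite /k linearP linearZ /= -[_ *: fn n z]/(t * fn n z) -[_ *: fn n z']/((1 - t) * fn n z').
have h2 : `|t *: z + (1 - t) *: z'| ^+ 2 <= (t * `|z| + (1 - t) * `|z'|) ^+ 2.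
  by rewrite ler_sqr ?nnegrE// (le_trans _ h1).
have := ler_wpM2l (ltW (A0 n)) h2.
set u := `|t *: z + _| ^+ 2; lra.
Qed.

Let val_convex M t w w' y y' : 0 <= t <= 1 ->
  val (t *: w + (1 - t) *: w') M (fun i => t *: y i + (1 - t) *: y' i) <=
  t * val w M y + (1 - t) * val w' M y' -
  \sum_(i < M) t * (1 - t) * A i * (`|y i| - `|y' i|) ^+ 2.
Proof.
move=> t01; rewrite /val big_split /= -!scaler_sumr.
have := phic (w - \sum_(i < M) y i) (w' - \sum_(i < M) y' i) t01.
rewrite !scalerBr addrACA -opprD.
have : \sum_(i < M) k i (t *: y i + (1 - t) *: y' i) <=
  t * \sum_(i < M) k i (y i) + (1 - t) * \sum_(i < M) k i (y' i) -
    \sum_(i < M) t * (1 - t) * A i * (`|y i| - `|y' i|) ^+ 2.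
  rewrite !mulr_sumr -sumrN -!big_split /=.
  by apply: ler_sum => i _; exact: k_convex.
lra.
Qed.

Let gain_ge0 M t (y y' : nat -> W) : 0 <= t <= 1 ->
  forall i : 'I_M, 0 <= t * (1 - t) * A i * (`|y i| - `|y' i|) ^+ 2.
Proof.
by move=> /andP[t0 t1] i; rewrite mulr_ge0 ?sqr_ge0// mulr_ge0 ?(ltW (A0 _))// mulr_ge0// subr_ge0.
Qed.

Let psi_convex : convex_on psi.
Proof.
move=> t w w' t01; apply/ler_addgt0Pr => e e0.
have [M [y [y' [_ h1 h2]]]] := psi_adh2 w w' 0 e0.
apply: le_trans (psi_le _ M (fun i => t *: y i + (1 - t) *: y' i)) _.
apply: le_trans (val_convex _ _ _ _ _ t01) _.
have : 0 <= \sum_(i < M) t * (1 - t) * A i * (`|y i| - `|y' i|) ^+ 2.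
  by apply: sumr_ge0 => i _; exact: gain_ge0.
move: t01 => /andP[t0 t1]; have t1' : 0 <= 1 - t by rewrite subr_ge0.
have := ler_wpM2l t0 h1; have := ler_wpM2l t1' h2; lra.
Qed.

Let psi_lipschitz : lipschitz_fun C psi.
Proof.
move=> w w'; rewrite -lerBlDr; apply: lb_le_inf => // _ [N [y ->]].
rewrite lerBlDr (le_trans (psi_le _ N y))// /val.
have := phiL (w - \sum_(i < N) y i) (w' - \sum_(i < N) y i).
by rewrite opprD opprK addrACA addNr addr0; lra.
Qed.

(** The [n]-th component absorbs the displacement [z], so the argument of [phi] is unchanged and
    only the term [k n] varies. *)
Let val_upd w M y n z : (n < M)%N ->
  psi (w + z) <= val w M y - k n (y n) + k n (y n + z).
Proof.
move=> nM; pose i0 := Ordinal nM.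
apply: le_trans (psi_le _ M (fun i => if i == n then y n + z else y i)) _.
rewrite /val (bigD1 i0)//= eqxx [X in _ + X <= _](bigD1 i0)//= eqxx.
rewrite [\sum_(i < M) y i](bigD1 i0)//= [\sum_(i < M) k i (y i)](bigD1 i0)//=.
have -> : \sum_(i < M | i != i0) (if i == n :> nat then y n + z else y i) =
    \sum_(i < M | i != i0) y i.
  by apply: eq_bigr => i /negbTE; rewrite -val_eqE /= => ->.
have -> : \sum_(i < M | i != i0) k i (if i == n :> nat then y n + z else y i) =
    \sum_(i < M | i != i0) k i (y i).
  by apply: eq_bigr => i /negbTE; rewrite -val_eqE /= => ->.
have -> : w + z - (y n + z + \sum_(i < M | i != i0) y i) =
    w - (y n + \sum_(i < M | i != i0) y i).
  by rewrite (addrC (y n) z) -[z + y n + _]addrA addrKA.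
lra.
Qed.

(** If a subgradient at [w] is close to [fn n], then the [n]-th component of a near-optimal
    decomposition of [w] is short, hence so is that of a nearby [w']. Subgradients at [w'] are then
    close to the slope of [k n] there, and so to [fn n]. *)
Let subgrad_close w w' n (f g : dual W) e :
  0 < e -> `|f - fn n| < e ->
  (forall h, f h <= psi (w + h) - psi w) ->
  (forall h, g h <= psi (w' + h) - psi w') ->
  C * `|w - w'| <= e ^+ 2 / A n -> forall z, g z - fn n z <= 12 * e * `|z|.
Proof.
move=> e0 fe fP gP ww z.
have An0 := A0 n; have t0 : 0 < e ^+ 2 / A n by rewrite divr_gt0// exprn_gt0.
have [M [y [y' [nM h1 h2]]]] := psi_adh2 w w' n t0.
set a := `|y n|; set b := `|y' n|.
have fne x : f x - fn n x <= e * `|x|.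
  have := dual_le_norm (f - fn n) x; rewrite -[(f - fn n) x]/(f x - fn n x).
  move=> /(le_trans (ler_norm _)) /le_trans; apply.
  by rewrite ler_wpM2r// ltW.
(* Deleting the [n]-th component displaces [w] by [- y n]; the subgradient inequality for [f] bounds
   the quadratic cost saved by [f (y n) - fn n (y n)] plus the near-optimality error. *)
have a1 : A n * a ^+ 2 <= e * a + e ^+ 2 / A n.
  have := val_upd w y (- y n) nM; have := fP (- y n); have := fne (y n).
  rewrite subrr /k linearN linear0 normr0 expr0n mulr0 -/a /=; lra.
have aa : A n * a <= 2 * e.
  have : (A n * a) ^+ 2 <= e * (A n * a) + e ^+ 2.
    have := ler_wpM2l (ltW An0) a1; rewrite mulrDr.
    have -> : A n * (e ^+ 2 / A n) = e ^+ 2 by field; rewrite gt_eqF.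
    lra.
  have : 0 <= A n * a by exact: mulr_ge0 (ltW An0) (normr_ge0 _).
  set q := A n * a => q0 q1; rewrite leNgt; apply/negP => q2; nra.
(* Averaging the two decompositions gives a competitor at the midpoint of [w] and [w']. The
   convexity gain there is at most of order [e ^+ 2 / A n], which forces
   [A n * |a - b| <= 3 * e]. *)
have bb : A n * b <= 5 * e.
  have half01 : (0 : R) <= 1 / 2 by rewrite divr_ge0.
  have h01 : 0 <= (1 / 2 : R) <= 1 by apply/andP; split; lra.
  have := val_convex M w w' y y' h01.
  have := psi_le ((1/2) *: w + (1 - 1/2) *: w') M (fun i => (1/2) *: y i + (1 - 1/2) *: y' i).
  have : (1/2) * (1 - 1/2) * A n * (a - b) ^+ 2 <=
      \sum_(i < M) (1/2) * (1 - 1/2) * A i * (`|y i| - `|y' i|) ^+ 2.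
    rewrite (bigD1 (Ordinal nM))//= lerDl; apply: sumr_ge0 => i _; exact: gain_ge0.
  have := psi_lipschitz w ((1/2) *: w + (1 - 1/2) *: w').
  have := psi_lipschitz w' ((1/2) *: w + (1 - 1/2) *: w').
  have e2 : (1 - 1/2 : R) = 1/2 by lra.
  rewrite e2 -scalerDr.
  have hw v : v = (1/2) *: v + (1/2) *: v :> W.
    by rewrite -scalerDl (_ : 1/2 + 1/2 = 1 :> R) ?scale1r//; lra.
  have d1 : w - (1/2) *: (w + w') = (1/2) *: (w - w').
    by rewrite {1}(hw w) scalerDr opprD addrACA subrr add0r -scalerBr.
  have d2 : w' - (1/2) *: (w + w') = (1/2) *: (w' - w).
    by rewrite {1}(hw w') scalerDr opprD addrACA subrr addr0 -scalerBr.
  rewrite d1 d2 (normrZ _ (w - w')) (normrZ _ (w' - w)) (ger0_norm half01).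
  rewrite (distrC w') => p1 p2 p3 p4 p5.
  have q1 : A n * (a - b) ^+ 2 <= 8 * (e ^+ 2 / A n).
    move: ww t0 p1 p2 p3 p4 p5 h1 h2; set dd := C * `|w - w'|.
    set S := \sum_(i < M) _; set T := psi (_ *: _); set V := val (_ *: _) _ _.
    rewrite !(mulrCA C) -/dd; lra.
  have q2 : (A n * b - A n * a) ^+ 2 <= 8 * e ^+ 2.
    have := ler_wpM2l (ltW An0) q1.
    have -> : A n * (8 * (e ^+ 2 / A n)) = 8 * e ^+ 2 by field; rewrite gt_eqF.
    have -> : A n * (A n * (a - b) ^+ 2) = (A n * b - A n * a) ^+ 2 by ring.
    by [].
  rewrite leNgt; apply/negP => q3.
  have q4 : 3 * e < A n * b - A n * a by lra.
  have : (3 * e) ^+ 2 < (A n * b - A n * a) ^+ 2.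
    by rewrite ltr_sqr ?nnegrE//; lra.
  nra.
have [->|z0] := eqVneq z 0; first by rewrite (linear0 g) (linear0 (fn n)) normr0 mulr0 subr0.
have nz : 0 < `|z| by rewrite normr_gt0.
(* At this step length the cross term [2 * A n * b * s |z|], the square term and the near-optimality
   error are at most 10, 1 and 1 times [e ^+ 2 / A n]; hence the 12. *)
pose s := e / (A n * `|z|); have s0 : 0 < s by rewrite divr_gt0// mulr_gt0.
have := val_upd w' y' (s *: z) nM; have := gP (s *: z).
have gs : g (s *: z) = s * g z by exact: linearZ.
have fs : fn n (y' n + s *: z) = fn n (y' n) + s * fn n z by rewrite linearD linearZ.
rewrite /k gs fs -/b.
have nn : `|y' n + s *: z| <= b + s * `|z|.
  by rewrite (le_trans (ler_normD _ _))// normrZ gtr0_norm.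
have nn2 : `|y' n + s *: z| ^+ 2 <= (b + s * `|z|) ^+ 2.
  by rewrite ler_sqr ?nnegrE// (le_trans _ nn).
have := ler_wpM2l (ltW An0) nn2.
have sz : s * `|z| = e / A n by rewrite /s; field; rewrite !gt_eqF.
have -> : A n * (b + s * `|z|) ^+ 2 = A n * b ^+ 2 + 2 * (A n * b) * (e / A n) + e ^+ 2 / A n.
  by rewrite sz; field; rewrite gt_eqF.
have : 2 * (A n * b) * (e / A n) <= 10 * (e ^+ 2 / A n).
  have -> : 10 * (e ^+ 2 / A n) = 2 * (5 * e) * (e / A n) by field; rewrite gt_eqF.
  by rewrite ler_pM2r ?divr_gt0// ler_pM2l.
move=> r1 r2 r3 r4.
have r5 : s * (g z - fn n z) <= 12 * (e ^+ 2 / A n).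
  move: r1 r2 r3 r4 h2 t0; set p := A n * (`|y' n + _| ^+ 2); rewrite mulrBr; lra.
have := r5; rewrite -(ler_pM2l s0).
have -> : 12 * (e ^+ 2 / A n) = s * (12 * e * `|z|).
  by rewrite /s; field; rewrite !gt_eqF.
by rewrite !ler_pM2l.
Qed.

(** Subgradients [g] and [g'] at [w + h] and [w - h] bound the second difference by [g h - g' h].
    Both lie within [12 * (e / 24)] of the same [fn n], so this is at most [e |h|]. *)
Let psi_smooth : smooth psi.
Proof.
move=> w e e0.
have [f fP] := subgradient w psi_convex psi_lipschitz.
have e1 : 0 < e / 24 by rewrite divr_gt0.
have [n fe] := fn_dense f e1.
exists ((e / 24) ^+ 2 / A n / (C + 1)).
  by rewrite !divr_gt0 ?exprn_gt0// ltr_wpDl.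
move=> h; rewrite ltr_pdivlMr ?ltr_wpDl// => hd.
have [g gP] := subgradient (w + h) psi_convex psi_lipschitz.
have [g' g'P] := subgradient (w - h) psi_convex psi_lipschitz.
have hC : C * `|h| <= (e / 24) ^+ 2 / A n.
  by rewrite (le_trans _ (ltW hd))// mulrC ler_wpM2l// lerDl.
have c1 : C * `|w - (w + h)| <= (e / 24) ^+ 2 / A n.
  by rewrite opprD addrA subrr add0r normrN.
have c2 : C * `|w - (w - h)| <= (e / 24) ^+ 2 / A n.
  by rewrite opprD addrA subrr add0r opprK.
have := subgrad_close e1 fe fP gP c1 h.
have := subgrad_close e1 fe fP g'P c2 (- h).
have := gP (- h); have := g'P h; rewrite (addrK h w) (subrK h w).
rewrite (linearN g) (linearN g') (linearN (fn n)) normrN; lra.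
Qed.

Lemma smooth_approximation : exists psi : W -> R,
  [/\ convex_on psi, lipschitz_fun C psi, smooth psi &
      forall x, phi x - c <= psi x <= phi x].
Proof.
exists psi; split => // x; apply/andP; split.
  by apply: lb_le_inf => // _ [N [y ->]].
by have := psi_le x 0 (fun=> 0); rewrite /val !big_ord0 subr0 addr0.
Qed.

End Smoothing.

(** * Separable reduction *)

(** Frechet normality without quotient or limsup; [fnormal_frechet] leads back to
    [frechet_normal]. *)
Definition fnormal (R : realType) (Z : normedModType R) (S : set Z) (z : Z) (f : dual Z) :=
  S z /\ forall e : R, 0 < e -> exists2 d : R, 0 < d &
    forall s, S s -> `|s - z| < d -> f (s - z) <= e * `|s - z|.

Definition separable_duals (R : realType) (E : normedModType R) :=
  forall V : submodClosed E,
    separable (subspace_of V) -> separable (dual (subspace_of V)).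

Lemma dense_seq (R : realType) (W : normedModType R) : separable W ->
  exists fn : nat -> W, forall (f : W) (e : R), 0 < e -> exists n, `|f - fn n| < e.
Proof.
move=> [D /countable_injP[i] iI Dd].
exists (fun n => xget 0 [set d | D d /\ i d = n]) => f e e0.
have [|d [fd Dd']] := Dd (ball f e) _ (ball_open f e); first by exists f; exact: ballxx.
exists (i d); suff -> : xget 0 [set d' | D d' /\ i d' = i d] = d.
  by move: fd; rewrite -ball_normE.
case: xgetP => [y _ [Dy yd]|/(_ d)]; last by move=> /(_ (conj Dd' erefl)).
by apply: iI => //; apply/mem_set.
Qed.

Section FuzzySeparable.
Context (R : realType) (W : normedModType R).

(** At a local minimiser [v] on [S] of the smooth convex function [psi + G], take a subgradient [f].
    For [s] in [S], the value at [s] is at least that at [v], so the second difference bound forces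
    the value at [v - (s - v)] to exceed it by at most [e |s - v|]; hence [- f] is Frechet
    normal. *)
Lemma fuzzy_min_separable (S : set W) (phi : W -> R) (C r kappa eta : R) (ubar : W) :
  separable (dual W) -> seq_complete S -> convex_on phi -> lipschitz_fun C phi -> 0 <= C ->
  S ubar -> 0 < r -> 0 < kappa -> 0 < eta ->
  (forall s, S s -> `|s - ubar| <= r -> phi ubar <= phi s) ->
  exists (u : W) (f : dual W), [/\ `|u - ubar| < r, fnormal S u (- f) &
    forall h, f h <= phi (u + h) - phi u + kappa * `|h| + eta].
Proof.
move=> /dense_seq[fn fnd] Sc phic phiL C0 Su r0 k0 eta0 phimin.
pose c := Num.min eta (kappa * r / 64).
have c0 : 0 < c by rewrite lt_min eta0 divr_gt0// mulr_gt0.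
have [psi [psic psiL psis psin]] := smooth_approximation fnd phic phiL C0 c0.
have ex (a : R) : exists th : W -> R, 0 < a -> [/\ convex_on th, lipschitz_fun 1 th, smooth th &
      forall x, `|x| - a <= th x <= `|x|].
  have [a0|a0] := ltP 0 a; last by exists (fun=> 0).
  have [th h] := smooth_approximation fnd (@norm_convex R W) (@norm_lipschitz R W) ler01 a0.
  by exists th.
have [th thP] := choice ex.
have [|a /thP[]//|a /thP[]//|a x a0|G [v [Gc GL Sv vu [vmin Gs]]]] :=
    @variational_principle R W psi C S ubar kappa r th psiL Sc Su k0 r0.
- move=> s Ss sr; have := phimin s Ss sr.
  have /andP[_ h1] := psin ubar; have /andP[h2 _] := psin s.
  have : c <= kappa * r / 64 by rewrite ge_min lexx orbT.
  lra.
- by have [_ _ _ /(_ x)/andP[-> h]] := thP a a0; rewrite /= (le_trans h)// lerDl ltW.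
have {}Gs : smooth G by apply: Gs => a /thP[].
have [f fP] := @subgradient _ _ (fun x => psi x + G x) (C + kappa) v (convex_onD psic Gc)
  (fun x y => ltac:(have := psiL x y; have := GL x y; rewrite mulrDl; lra)).
exists v, f; split=> //.
- split=> // e e0; have [d d0 dP] := smoothD psis Gs v e0.
  exists (Num.min d (r - `|v - ubar|)); first by rewrite lt_min d0 subr_gt0.
  move=> s Ss; rewrite lt_min => /andP[/dP h1 h2].
  have := vmin s Ss; rewrite -(subrKA v) => /(_ ltac:(apply: le_trans (ler_normD _ _) _; lra)).
  move: h1; rewrite subrKC -[(- f) _]/(- f _) -(linearN f).
  have := fP (- (s - v)); lra.
- move=> h; have := fP h; have := GL (v + h) v; rewrite (addrAC v) subrr add0r.
  have /andP[_ h1] := psin (v + h); have /andP[h2 _] := psin v.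
  have : c <= eta by rewrite ge_min lexx.
  lra.
Qed.

End FuzzySeparable.

Lemma countable_closure (T : Type) (I : countType) (op : I -> T -> T -> T) (A : set T) :
  countable A -> exists D : set T, [/\ countable D, A `<=` D &
    forall i x y, D x -> D y -> D (op i x y)].
Proof.
move=> Ac.
pose op' (i : option I) x y := if i is Some j then op j x y else x.
(* The extra operation [None] returns its first argument, which makes the stages [Dn] increasing. *)
pose step (B : set T) := (fun z => op' z.1 z.2.1 z.2.2) @` ([set: option I] `*` (B `*` B)).
pose Dn n := iter n step A.
have Dc n : countable (Dn n).
  elim: n => //= n IH; apply: sub_countable (card_image_le _ _) _.
  by do 2?[apply: countableX => //].
have mono n m : (n <= m)%N -> Dn n `<=` Dn m.
  move=> /subnKC <-; elim: (m - n)%N => [|k IH]; first by rewrite addn0.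
  by rewrite addnS => x /IH Dx; exists (None, (x, x)).
exists (\bigcup_n Dn n); split.
- exact: bigcup_countable.
- by move=> x Ax; exists 0%N.
- move=> i x y [n _ nx] [m _ my]; exists (maxn n m).+1 => //.
  exists (Some i, (x, y)) => //; split=> //; split; [apply: mono nx|apply: mono my].
    exact: leq_maxl.
  exact: leq_maxr.
Qed.

Section SeparableReduction.
Context (R : realType) (E : normedModType R).

Definition closure_pred (D : set E) : {pred E} :=
  fun x => `[< forall e : R, 0 < e -> exists2 d, D d & `|x - d| < e >].

Lemma closure_predP D x :
  reflect (forall e : R, 0 < e -> exists2 d, D d & `|x - d| < e) (x \in closure_pred D).
Proof. exact: asboolP. Qed.

Lemma sub_closure_pred (D : set E) d : D d -> d \in closure_pred D.
Proof. by move=> Dd; apply/closure_predP => e e0; exists d; rewrite // subrr normr0. Qed.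

Lemma closure_pred_limit D (u : nat -> E) l :
  (forall n, u n \in closure_pred D) -> u @ \oo --> l -> l \in closure_pred D.
Proof.
move=> uD ul; apply/closure_predP => e e0; have e20 : 0 < e / 2 by rewrite divr_gt0.
have /cvgrPdist_lt/(_ _ e20)[N _ NP] := ul.
have /closure_predP/(_ _ e20)[d Dd dP] := uD N.
exists d => //; rewrite -(subrKA (u N)) (le_lt_trans (ler_normD _ _))//.
have := NP N (leqnn _) => /= ?; lra.
Qed.

Lemma closure_pred_submod (D : set E) : D !=set0 ->
  (forall (q : rat) x y, D x -> D y -> D (ratr q *: x + y)) ->
  submod_closed (closure_pred D).
Proof.
move=> [d0 Dd0] Dl; split=> [|a u v /closure_predP Du /closure_predP Dv].
  apply: sub_closure_pred; have := Dl (-1) _ _ Dd0 Dd0.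
  by rewrite rmorphN1 scaleN1r addNr.
apply/closure_predP => e e0.
have e1 : 0 < e / (3 * (`|a| + 1)) by rewrite divr_gt0// mulr_gt0// ltr_wpDl.
have [d Dd dP] := Du _ e1.
have [d' Dd' d'P] := Dv _ (divr_gt0 e0 (ltr0n R 3)).
have e2 : 0 < e / (3 * (`|d| + 1)) by rewrite divr_gt0// mulr_gt0// ltr_wpDl.
have [|q] := @rat_in_itvoo R (a - e / (3 * (`|d| + 1))) (a + e / (3 * (`|d| + 1))); first by lra.
rewrite in_itv /= => /andP[q1 q2].
exists (ratr q *: d + d'); first exact: Dl.
have -> : a *: u + v - (ratr q *: d + d') = a *: (u - d) + (a - ratr q) *: d + (v - d').
  by rewrite opprD addrACA scalerBr scalerBl subrKA.
rewrite (le_lt_trans (ler_normD _ _))// (le_lt_trans (lerD (ler_normD _ _) (lexx _)))//.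
rewrite !normrZ.
have h1 : `|a| * `|u - d| <= e / 3.
  apply: le_trans (ler_wpM2l (normr_ge0 _) (ltW dP)) _.
  have a1 : 0 < `|a| + 1 by rewrite ltr_wpDl.
  rewrite mulrC -mulrA ler_pM2l// ler_pdivrMl ?mulr_gt0//; lra.
have h2 : `|a - ratr q| * `|d| <= e / 3.
  have qd : `|a - ratr q| <= e / (3 * (`|d| + 1)) by rewrite ler_norml; apply/andP; split; lra.
  apply: le_trans (ler_wpM2r (normr_ge0 _) qd) _.
  have a1 : 0 < `|d| + 1 by rewrite ltr_wpDl.
  rewrite -mulrA ler_pM2l// ler_pdivrMl ?mulr_gt0//; lra.
lra.
Qed.

Lemma separable_subspace (D : set E) (V : submodClosed E) :
  V =i closure_pred D -> countable D -> separable (subspace_of V).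
Proof.
move=> VD Dc; exists ((fun d => insubd (0 : subspace_of V) d) @` D).
  exact: sub_countable (card_image_le _ _) Dc.
move=> O [v Ov] Oo.
have /nbhs_ballP[e /= e0 eO] : nbhs v O by exact: open_nbhs_nbhs.
have := subspace_valP v; rewrite VD => /closure_predP/(_ e e0)[d Dd dP].
exists (insubd (0 : subspace_of V) d); split; last by exists d.
apply: eO; rewrite -ball_normE /=.
rewrite -[`|_|]/(`|val (v - insubd (0 : subspace_of V) d)|) raddfB /= val_insubd.
by rewrite VD (sub_closure_pred Dd).
Qed.

End SeparableReduction.

Section FuzzyMinimum.
Context (R : realType) (E : normedModType R).
Variables (S : set E) (phi : E -> R) (C kappa eta : R).
Hypotheses (phic : convex_on phi) (phiL : lipschitz_fun C phi).
Hypotheses (C0 : 0 <= C) (k0 : 0 < kappa) (eta0 : 0 < eta).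

(* An item [(lam, s, (k, n))] stands for the constraint
   [f (- lam (s - u)) <= lam |s - u| / (k + 1)], to be imposed for [s] in [S]
   within distance of order [1 / (n + 1)] from [u]. *)
Let item := (R * E * (nat * nat))%type.
Let comb (u : E) (L : seq item) := \sum_(p <- L) p.1.1 *: (p.1.2 - u).
Let cost (u : E) (L : seq item) := \sum_(p <- L) p.1.1 * (`|p.1.2 - u| / p.2.1.+1%:R).
Let mass (L : seq item) := \sum_(p <- L) p.1.1.
Let tilt u h := phi (u + h) - phi u + kappa * `|h| + eta.
(** By [convex_sandwich] on the cone of pairs [(comb u L, cost u L)], a functional below [tilt u]
    satisfying all constraints exists as soon as no defect is negative. *)
Let defect u L := tilt u (comb u L) + cost u L.
(** The factor [a] leaves room to move the base point: lists start with [a = 1 / 2] at [u], are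
    replaced by lists with [a = 3 / 4] at a nearby point, and are used at [u] with radius factor
    1. *)
Let admissible a u (L : seq item) :=
  forall p, p \in L -> [/\ 0 <= p.1.1, S p.1.2 & `|p.1.2 - u| < a / p.2.2.+1%:R].

Let mass_ge0 a u L : admissible a u L -> 0 <= mass L.
Proof. by move=> La; rewrite /mass big_seq; apply: sumr_ge0 => p /La[]. Qed.

Let combB u u' L : comb u' L = comb u L + mass L *: (u - u').
Proof.
rewrite /comb /mass scaler_suml -big_split /=; apply: eq_bigr => p _.
by rewrite -scalerDr subrKA.
Qed.

Let cost_lip a u u' L : admissible a u L ->
  cost u' L <= cost u L + mass L * `|u - u'|.
Proof.
move=> La; rewrite /cost /mass mulr_suml -big_split /= big_seq [leRHS]big_seq.
apply: ler_sum => p /La[p0 _ _]; rewrite -mulrDr ler_wpM2l//.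
have k1 : 0 <= p.2.1.+1%:R^-1 :> R by rewrite invr_ge0.
have h : `|p.1.2 - u'| <= `|p.1.2 - u| + `|u - u'| by rewrite -(subrKA u) ler_normD.
apply: le_trans (ler_wpM2r k1 h) _.
rewrite mulrDl lerD2l ler_piMr// invf_le1// ler1n //.
Qed.

Let defect_lip a u u' L : admissible a u L ->
  defect u' L <= defect u L + (2 * C + (C + kappa + 1) * mass L) * `|u - u'|.
Proof.
move=> La; have m0 := mass_ge0 La; rewrite /defect /tilt (combB u u').
have := cost_lip u' La; have := phiL u u'.
set d := `|u - u'|; set c := comb u L; set m := mass L.
have := phiL (u' + (c + m *: (u - u'))) (u + c).
have -> : u' + (c + m *: (u - u')) - (u + c) = (u' - u) + m *: (u - u').
  by rewrite addrA [u' + c + _]addrAC (addrC u c) addrKA addrAC.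
have h1 : `|u' - u + m *: (u - u')| <= d + m * d.
  by rewrite (le_trans (ler_normD _ _))// normrZ (ger0_norm m0) distrC.
have h2 := ler_wpM2l C0 h1.
have h3 : `|c + m *: (u - u')| <= `|c| + m * d.
  by rewrite (le_trans (ler_normD _ _))// normrZ (ger0_norm m0).
have := ler_wpM2l (ltW k0) h3; move: h2.
set x1 := phi (u' + _); set x2 := phi (u + c); set x3 := `|c + _|; set x4 := `|u' - u + _|.
have : 0 <= m * d by exact: mulr_ge0 m0 (normr_ge0 _).
lra.
Qed.

(** The countable part of a violating list: its tags, an integer bound on its mass, which by
    [defect_lip] bounds the sensitivity to the base point, and [m] such that the defect is below
    [- 1 / (m + 1)]. Real weights and points are left to a choice function, so countably many
    operations suffice. *)
Let prm := (seq (nat * nat) * nat * nat)%type.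
Let witness (u : E) (p : prm) (L : seq item) :=
  [/\ map snd L = p.1.1, admissible (3 / 4) u L, mass L <= p.1.2%:R &
      defect u L < - p.2.+1%:R^-1].

Lemma fuzzy_min (r : R) (ubar : E) :
  separable_duals E -> seq_complete S ->
  S ubar -> 0 < r -> (forall s, S s -> `|s - ubar| <= r -> phi ubar <= phi s) ->
  exists (u : E) (f : dual E), [/\ `|u - ubar| < r, fnormal S u (- f) &
    forall h, f h <= phi (u + h) - phi u + kappa * `|h| + eta].
Proof.
move=> Esep Sc Su r0 phimin.
have exw (z : E * prm) : exists L, (exists L', witness z.1 z.2 L') -> witness z.1 z.2 L.
  have [[L LP]|n] := pselect (exists L', witness z.1 z.2 L'); first by exists L.
  by exists [::].
have [wit witP] := choice exw.
pose op (i : rat + prm * nat) x y := match i with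
  | inl q => ratr q *: x + y
  | inr pi => (nth (0, 0, (0%N, 0%N)) (wit (x, pi.1)) pi.2).1.2 end.
have [D [Dc Dubar Dop]] := countable_closure op (countable1 ubar).
have Du : D ubar by exact: Dubar.
have Dl (q : rat) x y : D x -> D y -> D (ratr q *: x + y) by exact: (Dop (inl q)).
have Dw x p q : D x -> q \in wit (x, p) -> D q.1.2.
  by move=> Dx /(nthP (0, 0, (0%N, 0%N)))[i _ <-]; exact: (Dop (inr (p, i)) x x).
pose V : submodClosed E := HB.pack (closure_pred D)
  (GRing.isSubmodClosed.Build R E (closure_pred D) (closure_pred_submod (ex_intro _ _ Du) Dl)).
pose W := subspace_of V.
have VD : V =i closure_pred D by [].
have Wsep : separable (dual W) by apply: Esep; exact: separable_subspace VD Dc.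
have inV d : D d -> d \in V by move=> Dd; exact: sub_closure_pred.
pose lift (x : E) : W := insubd 0 x.
have liftK x : x \in V -> val (lift x) = x by move=> xV; rewrite /lift val_insubd xV.
pose SW := [set v : W | S (val v)].
have normW (v : W) : `|v| = `|val v| by [].
have valD (v w : W) : val (v + w) = val v + val w by exact: raddfD.
have valB (v w : W) : val (v - w) = val v - val w by exact: raddfB.
have val0 : val (0 : W) = 0 by exact: raddf0.
have valZ t (v : W) : val (t *: v) = t *: val v by exact: linearZ.
have SWc : seq_complete SW.
  move=> w wS wc; have [||l Sl wl] := Sc (fun n => val (w n)).
  + exact: wS.
  + move=> e /wc[n nP]; exists n => i j ni nj.
    by have := nP i j ni nj; rewrite normW valB.
  have lV : l \in V by apply: closure_pred_limit wl => n; exact: subspace_valP.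
  exists (lift l); first by rewrite /SW /= liftK.
  apply/cvgrPdist_lt => e e0; have /cvgrPdist_lt/(_ e e0) := wl.
  by apply: filterS => n; rewrite normW valB liftK.
have phicW : convex_on (fun v : W => phi (val v)).
  by move=> t x y t01; rewrite valD !valZ; exact: phic.
have phiLW : lipschitz_fun C (fun v : W => phi (val v)).
  by move=> x y; rewrite normW valB; exact: phiL.
have [|s Ss|v [f [vu [Sv fN] fP]]] := @fuzzy_min_separable R W SW _ C r kappa eta (lift ubar)
    Wsep SWc phicW phiLW C0 _ r0 k0 eta0.
- by rewrite /SW /= liftK// inV.
- by rewrite normW valB liftK ?inV//; exact: phimin.
(* Normality relative to [V] fixes one radius per tolerance [1 / (k + 1)]; the same radii, halved,
   are then demanded in the whole space. *)
have exn (k : nat) : exists n : nat, forall s, SW s -> `|s - v| < n.+1%:R^-1 ->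
    - f (s - v) <= `|s - v| / k.+1%:R.
  have k1 : 0 < k.+1%:R^-1 :> R by rewrite invr_gt0.
  have [d d0 dP] := fN _ k1.
  exists (Num.bound d^-1) => s Ss sd; rewrite mulrC; apply: dP => //.
  apply: lt_trans sd _; rewrite invf_plt ?posrE ?ltr0Sn//.
  have := archi_boundP (ltW (_ : 0 < d^-1)); rewrite invr_gt0 => /(_ d0).
  by move=> /lt_trans; apply; rewrite ltr_nat.
have [n_ nP] := choice exn.
pose u := val v.
pose good (L : seq item) := admissible (1 / 2) u L /\ forall p, p \in L -> p.2.2 = n_ p.2.1.
have V_ge0 L : (forall p, p \in L -> [/\ 0 <= p.1.1, S p.1.2, p.1.2 \in V,
    `|p.1.2 - u| < p.2.2.+1%:R^-1 & p.2.2 = n_ p.2.1]) -> 0 <= defect u L.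
  move=> LP; pose h : W := \sum_(p <- L) p.1.1 *: (lift p.1.2 - v).
  have hE : val h = comb u L.
    rewrite /h (big_morph (fun w : W => val w) valD val0) /comb big_seq [RHS]big_seq; apply: eq_bigr => p /LP[_ _ pV _ _].
    by rewrite valZ valB liftK.
  have := fP h; rewrite normW valD hE -/u => h1.
  have h2 : - f h <= cost u L.
    rewrite /h (linear_sum f) /= -sumrN /cost big_seq [leRHS]big_seq.
    apply: ler_sum => p /LP[p0 pS pV pd pn].
    have -> : f (p.1.1 *: (lift p.1.2 - v)) = p.1.1 * f (lift p.1.2 - v) by exact: linearZ.
    rewrite -mulrN ler_wpM2l//.
    have eq : `|lift p.1.2 - v| = `|p.1.2 - u| by rewrite normW valB liftK.
    by rewrite -eq; apply: nP; rewrite /SW /= ?liftK// eq -pn.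
  rewrite /defect /tilt; lra.
(* The point [u] lies only in the closure of [D]. A violating list at [u] remains one at a close
   [u'] in [D]; there the chosen witness has its points in [D], and moved back to [u] it still
   violates, against [V_ge0]. *)
have good_ge0 L : good L -> 0 <= defect u L.
  move=> [La Ln]; rewrite leNgt; apply/negP => Lneg.
  pose Lam := Num.bound (mass L).
  have LamP : mass L <= Lam%:R by rewrite ltW// archi_boundP// (mass_ge0 La).
  pose K : R := 2 * C + (C + kappa + 1) * Lam%:R.
  have K0 : 0 <= K by rewrite /K addr_ge0// mulr_ge0// !addr_ge0// ltW.
  have Kle L' : mass L' <= Lam%:R -> 2 * C + (C + kappa + 1) * mass L' <= K.
    by move=> L'm; rewrite /K lerD2l ler_wpM2l// !addr_ge0// ltW.
  pose gap := - defect u L; have gap0 : 0 < gap by rewrite oppr_gt0.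
  have gE : defect u L = - gap by rewrite /gap opprK.
  (* Each of the two moves between [u] and [u'] costs at most [1 / (m + 1) < gap / 3]: after the
     first the defect is still below [- 1 / (m + 1)], after the second still negative. *)
  pose m := Num.bound (3 / gap).
  have mP : m.+1%:R^-1 < gap / 3.
    rewrite invf_plt ?posrE ?divr_gt0 ?ltr0Sn// invf_div.
    rewrite (lt_trans (archi_boundP _)) ?ltr_nat// ltW// divr_gt0//.
  have m0 : 0 < m.+1%:R^-1 :> R by rewrite invr_gt0.
  pose N := \max_(p <- L) p.2.2.
  have NP p : p \in L -> (p.2.2 <= N)%N by move=> pL; exact: leq_bigmax_seq.
  have N0 : 0 < 1 / 4 / N.+1%:R :> R by rewrite !divr_gt0// ltr0Sn.
  pose sg := Num.min (1 / 4 / N.+1%:R) (m.+1%:R^-1 / (K + 1)).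
  have sg0 : 0 < sg by rewrite lt_min N0 divr_gt0// ltr_wpDl.
  have sgN p : (p.2.2 <= N)%N -> sg <= 1 / 4 / (p : item).2.2.+1%:R.
    move=> pN; apply: le_trans (_ : 1 / 4 / N.+1%:R <= _); first by rewrite ge_min lexx.
    by rewrite ler_pM2l ?divr_gt0// lef_pV2 ?posrE ?ltr0Sn// ler_nat.
  have uD : u \in closure_pred D by exact: (subspace_valP v).
  have [u' Du' u'd] := elimT (closure_predP _ _) uD sg sg0.
  have Kd : K * `|u - u'| <= m.+1%:R^-1.
    apply: le_trans (ler_wpM2l K0 (ltW u'd)) _.
    apply: le_trans (_ : K * (m.+1%:R^-1 / (K + 1)) <= _).
      by rewrite ler_wpM2l// ge_min lexx orbT.
    by rewrite mulrCA ger_pMr// ler_pdivrMr ?ltr_wpDl// mul1r lerDl.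
  have [L'map L'a L'm L'd] : witness u' (map snd L, Lam, m) (wit (u', (map snd L, Lam, m))).
    apply: (witP (u', _)); exists L; split=> //=.
      move=> p pL; have [p0 pS pd] := La _ pL; split=> //.
      rewrite -(subrKA u) (le_lt_trans (ler_normD _ _))//.
      have := sgN _ (NP _ pL); move: pd u'd.
      set q := p.2.2.+1%:R^-1; set x := `|_|; set y := `|_|; clearbody q x y; lra.
    have := defect_lip u' La; have := ler_wpM2r (normr_ge0 (u - u')) (Kle _ LamP).
    move: mP m0 Kd gE; clearbody gap K; set x := m.+1%:R^-1; set y := K * _.
    set z := (_ + _) * _; set q := defect u L; set q' := defect u' L.
    clearbody x y z q q'; lra.
  have : 0 <= defect u (wit (u', (map snd L, Lam, m))).
    apply: V_ge0 => p pL'; have [p0 pS pd] := L'a _ pL'.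
    have /mapP[q qL qp] : p.2 \in map snd L by move: L'map => /= <-; apply/mapP; exists p.
    have pn : p.2.2 = n_ p.2.1 by rewrite qp; exact: Ln.
    split=> //; first by apply: inV; exact: Dw pL'.
    rewrite -(subrKA u') (le_lt_trans (ler_normD _ _))// (distrC u').
    have := sgN p; rewrite {1}qp => /(_ (NP _ qL)).
    move: pd u'd; set x := p.2.2.+1%:R^-1; set y := `|_|; set z := `|_|.
    clearbody x y z; lra.
  have := defect_lip u L'a; have := ler_wpM2r (normr_ge0 (u' - u)) (Kle _ L'm).
  rewrite (distrC u' u); move: L'd Kd.
  set x := m.+1%:R^-1; set y := K * _; set z := (_ + _) * _.
  set q := defect u _; set q' := defect u' _; clearbody x y z q q'; lra.
pose P := [set a : E * R | exists2 L, good L & a = (comb u L, cost u L)].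
have [||||||F FP FN] := @convex_sandwich R E (tilt u) (C + kappa) P.
- move=> t x y t01; rewrite /tilt.
  have := norm_convex x y t01.
  have := phic (u + x) (u + y) t01; rewrite !scalerDr addrACA -scalerDl subrKC scale1r.
  move=> h1 /(ler_wpM2l (ltW k0)); lra.
- move=> x y; rewrite /tilt; have := phiL (u + x) (u + y).
  rewrite opprD addrACA subrr add0r.
  have := ler_wpM2l (ltW k0) (@norm_lipschitz R E x y); rewrite mul1r; lra.
- by exists [::]; [split|rewrite /comb /cost !big_nil].
- move=> _ _ [L1 [L1a L1n] ->] [L2 [L2a L2n] ->]; exists (L1 ++ L2).
    split=> p; rewrite mem_cat => /orP[pL|pL];
      [exact: L1a|exact: L2a|exact: L1n|exact: L2n].
  by rewrite /comb /cost !big_cat.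
- move=> t _ t0 [L [La Ln] ->]; exists [seq (t * p.1.1, p.1.2, p.2) | p <- L].
    split=> _ /mapP[p pL ->] /=; last exact: Ln.
    by have [p0 pS pd] := La _ pL; split=> //; rewrite mulr_ge0// ltW.
  rewrite /comb /cost !big_map scaler_sumr mulr_sumr /=.
  by congr pair; apply: eq_bigr => p _; rewrite ?scalerA ?mulrA.
- by move=> _ [L /good_ge0 h ->].
exists u, F; split=> //.
- by move: vu; rewrite normW valB liftK ?inV.
- split=> // e e0; pose k := Num.bound e^-1.
  have ke : k.+1%:R^-1 <= e.
    rewrite invf_ple ?posrE ?ltr0Sn// ltW// (lt_trans (archi_boundP _)) ?ltr_nat//.
    by rewrite invr_ge0 ltW.
  exists (1 / 2 / (n_ k).+1%:R); first by rewrite !divr_gt0// ltr0Sn.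
  move=> s Ss sd; have := FN (comb u [:: (1, s, (k, n_ k))], cost u [:: (1, s, (k, n_ k))]).
  rewrite /comb /cost !big_seq1 /= scale1r mul1r linearN => h.
  apply: le_trans (h _) _.
    exists [:: (1, s, (k, n_ k))]; last by rewrite /comb /cost !big_seq1 /= scale1r mul1r.
    by split=> p; rewrite inE => /eqP ->.
  by rewrite mulrC ler_wpM2r.
Qed.

End FuzzyMinimum.

(** * Duals of products *)

Section ProductDuals.
Context (R : realType).

Lemma seq_separable (W : normedModType R) (x_ : nat -> W) :
  (forall x (e : R), 0 < e -> exists n, `|x - x_ n| < e) -> separable W.
Proof.
move=> xd; exists (x_ @` [set: nat]).
  by apply: sub_countable (card_image_le _ _) _.
move=> O [v Ov] Oo; have /nbhs_ballP[e /= e0 eO] : nbhs v O by exact: open_nbhs_nbhs.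
have [n nP] := xd v e e0; exists (x_ n); split; last by exists n.
by apply: eO; rewrite -ball_normE.
Qed.

(** The cone is the graph of [- f], a linear subspace, so the one-sided bound holds at [w] and [- w]
    and becomes an equality. *)
Lemma bounded_extension (E : normedModType R) (V : submodClosed E)
  (f : dual (subspace_of V)) : exists F : dual E, forall w, F (val w) = f w.
Proof.
have fN (w : subspace_of V) : f (- w) = - f w by exact: linearN.
have f0 : f 0 = 0 by exact: linear0.
have [||||||F _ FP] := @convex_sandwich R E (fun x => `|f| * `|x|) `|f|
  [set a | exists w : subspace_of V, a = (val w, - f w)].
- exact: convex_onZ (@norm_convex R E).
- move=> x y; have := ler_wpM2l (normr_ge0 f) (@norm_lipschitz R E x y).
  by rewrite mul1r mulrDr.
- by exists 0; rewrite raddf0 f0 oppr0.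
- by move=> _ _ [v ->] [w ->]; exists (v + w); rewrite raddfD (linearD f) opprD.
- move=> t _ t0 [w ->]; exists (t *: w); congr pair.
  by rewrite /= mulrN; congr (- _); exact/esym/linearZ.
- move=> _ [w ->] /=; rewrite subr_ge0 (le_trans (ler_norm _))//.
  exact: (dual_le_norm f w).
have FN x : F (- x) = - F x by exact: linearN.
have le w : f w <= F (val w).
  by have := FP (val w, - f w) (ex_intro _ w erefl); rewrite FN lerN2.
exists F => w; apply/eqP; rewrite eq_le le andbT.
have := le (- w); have -> : val (- w) = - val w by exact: raddfN.
by rewrite fN FN lerN2.
Qed.

Lemma bounded_restriction (E : normedModType R) (V : submodClosed E) (F : dual E) :
  exists f : dual (subspace_of V), forall w, f w = F (val w).
Proof.
apply: (@dual_of_bounded _ _ (fun w : subspace_of V => F (val w)) `|F|).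
  move=> a x y; have -> : val (a *: x + y) = a *: val x + val y by exact: linearP.
  exact: linearP.
by move=> x; apply: le_trans (ler_norm _) (dual_le_norm F _).
Qed.

Lemma dual_prod_split (A B : normedModType R) (F : dual (A * B)%type) :
  exists F1 F2, F = dual_pair F1 F2.
Proof.
have [F1 F1P] : exists F1 : dual A, forall a, F1 a = F (a, 0).
  apply: (@dual_of_bounded _ _ (fun a => F (a, 0)) `|F|) => [t x y|x].
    have -> : (t *: x + y, 0) = t *: (x, 0) + (y, 0) :> A * B by congr pair; rewrite /= scaler0 addr0.
    by rewrite (linearD F); congr (_ + _); exact: linearZ.
  apply: le_trans (ler_norm _) (le_trans (dual_le_norm F _) _).
  by rewrite ler_wpM2l// prod_normE /= normr0 ge_max lexx normr_ge0.
have [F2 F2P] : exists F2 : dual B, forall b, F2 b = F (0, b).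
  apply: (@dual_of_bounded _ _ (fun b => F (0, b)) `|F|) => [t x y|x].
    have -> : (0, t *: x + y) = t *: (0, x) + (0, y) :> A * B by congr pair; rewrite /= scaler0 addr0.
    by rewrite (linearD F); congr (_ + _); exact: linearZ.
  apply: le_trans (ler_norm _) (le_trans (dual_le_norm F _) _).
  by rewrite ler_wpM2l// prod_normE /= normr0 ge_max lexx normr_ge0.
exists F1, F2; apply: val_inj; apply/funext => -[a b] /=.
rewrite F1P F2P -(linearD F); congr (F _).
by congr pair; rewrite /= ?addr0 ?add0r.
Qed.

Lemma separable_image (E A : normedModType R) (p : {linear E -> A}) (V : submodClosed E) :
  (forall x, `|p x| <= `|x|) -> separable (subspace_of V) ->
  exists2 V' : submodClosed A, separable (subspace_of V') & forall x, x \in V -> p x \in V'.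
Proof.
move=> pn /dense_seq[x_ xd].
pose P : {pred A} := fun a => `[< exists2 x, x \in V & a = p x >].
have Psub : submod_closed P.
  split; first by apply/asboolP; exists 0; rewrite ?rpred0 ?linear0.
  move=> a u v /asboolP[x xV ->] /asboolP[y yV ->]; apply/asboolP.
  by exists (a *: x + y); rewrite ?rpredD ?rpredZ// linearP.
pose V' : submodClosed A := HB.pack P (GRing.isSubmodClosed.Build R A P Psub).
have pV' x : x \in V -> p x \in V' by move=> xV; apply/asboolP; exists x.
exists V' => //.
pose lift a : subspace_of V' := insubd 0 a.
have liftK a : a \in V' -> val (lift a) = a by move=> aV; rewrite /lift val_insubd aV.
apply: (@seq_separable _ (fun n => lift (p (val (x_ n))))) => y e e0.
have /asboolP[x xV yx] := subspace_valP y.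
have [n nP] := xd (SubspaceOf xV) e e0; exists n.
rewrite -[`|_|]/(`|val (y - lift (p (val (x_ n))))|) raddfB /= liftK; last first.
  by apply: pV'; exact: subspace_valP.
by rewrite yx -linearB (le_lt_trans (pn _))//.
Qed.

(** A functional on [V] extends to the product, splits into two components, and these are
    approximated on the separable projections [VA] and [VB]. The approximants, extended and
    restricted back to [V], form a dense sequence indexed by pairs. *)
Lemma separable_duals_prod (A B : normedModType R) :
  separable_duals A -> separable_duals B -> separable_duals (A * B)%type.
Proof.
move=> Asep Bsep V Vsep.
have [VA VAsep VAP] := separable_image (p := fst) (fun z => (norm_fst_snd z).1) Vsep.
have [VB VBsep VBP] := separable_image (p := snd) (fun z => (norm_fst_snd z).2) Vsep.
have [f_ fd] := dense_seq (Asep _ VAsep).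
have [g_ gd] := dense_seq (Bsep _ VBsep).
have exh (nm : nat * nat) : exists h : dual (subspace_of V),
    forall w (a : subspace_of VA) (b : subspace_of VB), val a = (val w).1 -> val b = (val w).2 ->
      h w = f_ nm.1 a + g_ nm.2 b.
  have [F FP] := bounded_extension (f_ nm.1).
  have [G GP] := bounded_extension (g_ nm.2).
  have [h hP] := bounded_restriction V (dual_pair F G).
  by exists h => w a b aw bw; rewrite hP /= -aw -bw FP GP.
have [h hP] := choice exh.
apply: (@seq_separable _ (fun n => h (odflt (0%N, 0%N) (unpickle n)))) => f e e0.
have [F FP] := bounded_extension f.
have [F1 [F2 FE]] := dual_prod_split F; rewrite {}FE in FP.
have [f1 f1P] := bounded_restriction VA F1.
have [f2 f2P] := bounded_restriction VB F2.
have e3 : 0 < e / 3 by rewrite divr_gt0.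
have [n nP] := fd f1 _ e3; have [m mP] := gd f2 _ e3.
exists (pickle (n, m)); rewrite pickleK /=.
apply: (@le_lt_trans _ _ (e / 3 + e / 3)); last lra.
apply: dual_norm_le => w w1.
have wV : val w \in V by exact: subspace_valP.
pose a := SubspaceOf (VAP _ wV); pose b := SubspaceOf (VBP _ wV).
rewrite -[(f - _) w]/(f w - h (n, m) w) (hP _ w a b)//= -FP.
have -> : dual_pair F1 F2 (val w) = f1 a + f2 b by rewrite f1P f2P.
rewrite opprD addrACA (le_trans (ler_normD _ _))//.
have a1 : `|a| <= 1 by rewrite (le_trans _ w1)//; exact: (norm_fst_snd (val w)).1.
have b1 : `|b| <= 1 by rewrite (le_trans _ w1)//; exact: (norm_fst_snd (val w)).2.
have h1 := dual_norm_ge (f1 - f_ n) a1; have h2 := dual_norm_ge (f2 - g_ m) b1.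
by apply: lerD; [exact: le_trans h1 (ltW nP)|exact: le_trans h2 (ltW mP)].
Qed.

End ProductDuals.

(** * Normal cones *)

Section NormalCones.
Context (R : realType).

Lemma clarke_normal_scale (Z : normedModType R) (S : set Z) z t (f : dual Z) :
  0 < t -> clarke_normal S z f -> clarke_normal S z (t *: f).
Proof.
move=> t0 [Sz fT]; split=> // w /fT fw.
by rewrite -[(t *: f) w]/(t * f w) pmulr_rle0.
Qed.

Lemma fnormal_scale (Z : normedModType R) (S : set Z) z t (f : dual Z) :
  0 < t -> fnormal S z f -> fnormal S z (t *: f).
Proof.
move=> t0 [Sz fT]; split=> // e e0; have [d d0 dP] := fT _ (divr_gt0 e0 t0).
exists d => // s Ss sd; rewrite -[(t *: f) _]/(t * f _).
by rewrite -ler_pdivlMl// mulrA (mulrC _ e); exact: dP.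
Qed.

Lemma cvg_fst_snd (A B : normedModType R) (u : nat -> (A * B)%type) (z : (A * B)%type) :
  u @ \oo --> z -> (fun k => (u k).1) @ \oo --> (z.1 : A) /\ (fun k => (u k).2) @ \oo --> (z.2 : B).
Proof.
move=> /cvgrPdist_lt uz; split; apply/cvgrPdist_lt => e /uz; apply: filterS => n.
  exact: le_lt_trans (norm_fst_snd (z - u n)).1.
exact: le_lt_trans (norm_fst_snd (z - u n)).2.
Qed.

Lemma clarke_normal_prod (A B : normedModType R) (S : set A) (T : set B) z
    (f : dual A) (g : dual B) :
  clarke_normal (S `*` T) z (dual_pair f g) ->
  clarke_normal S z.1 f /\ clarke_normal T z.2 g.
Proof.
move=> [[Sz Tz] fT]; split; split=> // w Tw.
- have := fT (w, 0); rewrite /= linear0 addr0; apply=> u t uS uz t0 tl.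
  have [|wk wkw wkS] := Tw (fun k => (u k).1) t (fun k => (uS k).1) _ t0 tl.
    exact: (cvg_fst_snd uz).1.
  exists (fun k => (wk k, 0)); first by apply: cvg_pair => //; exact: cvg_cst.
  move=> k; split; first exact: wkS.
  by rewrite /= scaler0 addr0; exact: (uS k).2.
- have := fT (0, w); rewrite /= linear0 add0r; apply=> u t uS uz t0 tl.
  have [|wk wkw wkS] := Tw (fun k => (u k).2) t (fun k => (uS k).2) _ t0 tl.
    exact: (cvg_fst_snd uz).2.
  exists (fun k => (0, wk k)); first by apply: cvg_pair => //; exact: cvg_cst.
  move=> k; split; last exact: wkS.
  by rewrite /= scaler0 addr0; exact: (uS k).1.
Qed.

Lemma fnormal_prod (A B : normedModType R) (S : set A) (T : set B) z
    (f : dual A) (g : dual B) :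
  fnormal (S `*` T) z (dual_pair f g) -> fnormal S z.1 f /\ fnormal T z.2 g.
Proof.
case: z => z1 z2 [[/= Sz Tz] fT]; split; split=> // e /fT[d d0 dP]; exists d => // s Ss sd.
- have := dP (s, z2) (conj Ss Tz).
  have -> : (s, z2) - (z1, z2) = (s - z1, 0) by congr pair; rewrite /= subrr.
  by rewrite prod_normE /= subrr (linear0 g) addr0 normr0 max_l// => /(_ sd).
- have := dP (z1, s) (conj Sz Ss).
  have -> : (z1, s) - (z1, z2) = (0, s - z2) by congr pair; rewrite /= subrr.
  by rewrite prod_normE /= subrr (linear0 f) add0r normr0 max_r// => /(_ sd).
Qed.

Lemma fnormal_frechet (Z : normedModType R) (S : set Z) z (f : dual Z) :
  fnormal S z f -> frechet_normal S z f.
Proof.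
move=> [Sz fT]; split=> //; apply/lee_addgt0Pr => e e0; rewrite add0e.
have [d d0 dP] := fT e e0.
apply: ereal_inf_le; exists (ereal_sup [set (f (s - z) / `|s - z|)%:E | s in
    [set s | [/\ S s, `|s - z| < d & s != z]]]); last first.
  apply: ge_ereal_sup => _ [s [Ss sd sz] <-].
  by rewrite lee_fin ler_pdivrMr ?normr_gt0 ?subr_eq0//; exact: dP.
exists [set s | [/\ S s, `|s - z| < d & s != z]] => //.
have : \forall s \near z, `|s - z| < d.
  by apply/nbhs_ballP; exists d => //= s; rewrite -ball_normE /= distrC.
rewrite /within /dnbhs /=; apply: filterS => s sd sz Ss.
by split.
Qed.

Lemma clarke_tangent0 (Z : normedModType R) (S : set Z) z : clarke_tangent S z 0.
Proof.
move=> u t uS uz t0 tl; exists (fun=> 0); first exact: cvg_cst.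
by move=> k; rewrite scaler0 addr0.
Qed.

(** After the step along [v] the points are still in [S] and tend to [z], so the second tangent
    applies to them: the quantification over all base sequences is what makes the Clarke cone
    convex. *)
Lemma clarke_tangentD (Z : normedModType R) (S : set Z) z v w :
  clarke_tangent S z v -> clarke_tangent S z w -> clarke_tangent S z (v + w).
Proof.
move=> Tv Tw u t uS uz t0 tl; have [vk vkv vkS] := Tv u t uS uz t0 tl.
have [|wk wkw wkS] := Tw (fun k => u k + t k *: vk k) t vkS _ t0 tl.
  by rewrite -[z]addr0 -(scale0r v); apply: cvgD => //; exact: cvgZ.
exists (fun k => vk k + wk k); first exact: cvgD.
by move=> k; rewrite scalerDr addrA.
Qed.

Lemma clarke_tangentZ (Z : normedModType R) (S : set Z) z a v :
  0 < a -> clarke_tangent S z v -> clarke_tangent S z (a *: v).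
Proof.
move=> a0 Tv u t uS uz t0 tl.
have [||vk vkv vkS] := Tv u (fun k => t k * a) uS uz.
- by move=> k; rewrite mulr_gt0.
- by rewrite -(mul0r a); apply: cvgM => //; exact: cvg_cst.
exists (fun k => a *: vk k); first by apply: cvgZ => //; exact: cvg_cst.
by move=> k; rewrite scalerA.
Qed.

Lemma convex_diff_quotient (E : lmodType R) (phi : E -> R) u w t :
  convex_on phi -> 0 < t <= 1 -> phi u <= phi (u + t *: w) -> phi u <= phi (u + w).
Proof.
move=> phic /andP[t0 t1] h; have t01 : 0 <= t <= 1 by rewrite ltW.
have := phic t (u + w) u t01.
rewrite scalerDr addrAC -scalerDl subrKC scale1r => h2.
rewrite -(ler_pM2l t0); lra.
Qed.

(** Minimality along [ubar + t_k w_k] becomes [phi ubar <= phi (ubar + w_k)] by convexity and passes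
    to the limit by the Lipschitz bound. The sandwich with the convex cone of tangents then gives
    the subgradient. *)
Lemma clarke_min (E : normedModType R) (S : set E) (phi : E -> R) C r ubar :
  convex_on phi -> lipschitz_fun C phi -> 0 <= C -> S ubar -> 0 < r ->
  (forall s, S s -> `|s - ubar| <= r -> phi ubar <= phi s) ->
  exists f : dual E, clarke_normal S ubar (- f) /\
    forall h, f h <= phi (ubar + h) - phi ubar.
Proof.
move=> phic phiL C0 Su r0 phimin.
have Tmin w : clarke_tangent S ubar w -> phi ubar <= phi (ubar + w).
  move=> Tw; pose t k : R := k.+1%:R^-1.
  have tl : t @ \oo --> (0 : R) by exact: cvg_harmonic.
  have t0 k : 0 < t k by rewrite invr_gt0.
  have [||wk wkw wkS] := Tw (fun=> ubar) t _ _ t0 tl => //.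
    exact: cvg_cst.
  have tw : (fun k => t k *: wk k) @ \oo --> (0 : E).
    by rewrite -(scale0r w); exact: cvgZ.
  apply/ler_addgt0Pr => e e0.
  have e1 : 0 < e / (C + 1) by rewrite divr_gt0// ltr_wpDl.
  move/cvgrPdist_lt : tw => /(_ r r0) tw; move/cvgrPdist_lt : wkw => /(_ _ e1) wkw.
  have [N _ NP] := filterI tw wkw.
  have [] := NP N (leqnn N); rewrite /= sub0r normrN => h1 h2.
  have : phi ubar <= phi (ubar + wk N).
    apply: (@convex_diff_quotient _ _ _ _ (t N)) => //.
      by rewrite t0 invf_le1// ler1n.
    by apply: phimin; rewrite ?wkS// addrAC subrr add0r ltW.
  have := phiL (ubar + wk N) (ubar + w).
  rewrite opprD addrACA subrr add0r (distrC _ w).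
  move: h2; rewrite ltr_pdivlMr ?ltr_wpDl// mulrDr mulr1 mulrC.
  have := normr_ge0 (w - wk N); lra.
have [||||||f fP fN] := @convex_sandwich R E (fun h => phi (ubar + h) - phi ubar) C
    [set a | clarke_tangent S ubar a.1 /\ a.2 = 0].
- move=> t x y t01; have := phic t (ubar + x) (ubar + y) t01.
  rewrite !scalerDr addrACA -scalerDl subrKC scale1r => h; lra.
- move=> x y; have := phiL (ubar + x) (ubar + y); rewrite opprD addrACA subrr add0r; lra.
- by split=> //; exact: clarke_tangent0.
- by move=> a b [Ta ->] [Tb ->]; split; [exact: clarke_tangentD|rewrite /= addr0].
- by move=> t a t0 [Ta ->]; split; [exact: clarke_tangentZ|rewrite /= mulr0].
- by move=> a [Ta ->]; rewrite addr0 subr_ge0; exact: Tmin.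
exists f; split=> //; split=> // w Tw.
rewrite -[(- f) w]/(- f w) -(linearN f); exact: (fN (w, 0)).
Qed.

End NormalCones.

(** * Approximate stationarity and multipliers *)

Lemma dualZ (R : realType) (E : normedModType R) (f : dual E) t x : f (t *: x) = t * f x.
Proof. exact: linearZ. Qed.

Lemma dual_norm_le_mul (R : realType) (E : normedModType R) (f : dual E) K :
  0 <= K -> (forall x, f x <= K * `|x|) -> `|f| <= K.
Proof.
move=> K0 fK; apply: dual_norm_le => x x1.
have Kx : K * `|x| <= K by rewrite -[leRHS]mulr1 ler_wpM2l.
rewrite ler_norml lerNl -dualN; apply/andP; split; apply: le_trans (fK _) _ => //.
by rewrite normrN.
Qed.

(** Here [na], [nb], [nc] are norms of multipliers. Either [nb] dominates [e0 * (na + nc)], and then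
    [na + nb >= 3 / 4] bounds it below; or the qualification condition makes [na] at most [1 / 4],
    leaving [nb >= 1 / 2]. *)
Lemma multiplier_bounds (R : realType) (e0 kappa na nb nc : R) :
  0 < e0 -> 0 <= na -> 0 <= nb -> 0 <= nc -> kappa <= 1 / 12 -> kappa <= e0 / 8 ->
  kappa <= e0 / (2 * (1 + e0)) / 2 -> 1 - 3 * kappa <= na + nb ->
  (nb < e0 * (na + nc) -> e0 * (na + nc) <= 2 * kappa) ->
  e0 / (2 * (1 + e0)) <= nb /\ e0 * nc <= nb.
Proof.
move=> e00 na0 nb0 nc0 k1 k2 k3 ab small.
have e01 : 0 < 1 + e0 by rewrite addr_gt0.
set c0 := e0 / _ in k3 *.
have c0E : c0 * (2 * (1 + e0)) = e0 by rewrite /c0 divfK// gt_eqF// mulr_gt0.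
clearbody c0; have ea0 := mulr_ge0 (ltW e00) na0; have ec0 := mulr_ge0 (ltW e00) nc0.
have [h|/small h] := leP (e0 * (na + nc)) nb.
  split; last lra.
  have : e0 * (3 / 4) <= e0 * (na + nb) by rewrite ler_pM2l//; lra.
  by move=> h3; rewrite -(ler_pM2r e01); lra.
have c1 : c0 <= 1 / 2 by rewrite -(ler_pM2r (mulr_gt0 (ltr0n R 2) e01)) c0E; lra.
have sE : na <= 1 / 4 by rewrite -(ler_pM2l e00); lra.
split; lra.
Qed.

Lemma dual_pairZ (R : realType) (A B : normedModType R) t (f : dual A) (g : dual B) :
  t *: dual_pair f g = dual_pair (t *: f) (t *: g).
Proof. by apply: val_inj; apply/funext => z; exact: scalerDr. Qed.

Section Assembly.
Context (R : realType) (X Y : completeNormedModType R).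
Local Notation Z := (X * Y)%type.
Variable N : forall V : normedModType R, set V -> V -> set (dual V).
Hypothesis N_prod : forall (A B : normedModType R) (S : set A) (T : set B) z
    (f : dual A) (g : dual B),
  N (S `*` T) z (dual_pair f g) -> N S z.1 f /\ N T z.2 g.
Hypothesis N_scale : forall (V : normedModType R) (S : set V) z t (f : dual V),
  0 < t -> N S z f -> N S z (t *: f).
Hypothesis N_min : forall (S : set (Z * Z)) (phi : Z * Z -> R) (C r kappa eta : R)
    (ubar : Z * Z),
  seq_complete S -> convex_on phi -> lipschitz_fun C phi -> 0 <= C ->
  S ubar -> 0 < r -> 0 < kappa -> 0 < eta ->
  (forall s, S s -> `|s - ubar| <= r -> phi ubar <= phi s) ->
  exists (u : Z * Z) (f : dual (Z * Z)%type), [/\ S u, `|u - ubar| < r, N S u (- f) &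
    forall h, f h <= phi (u + h) - phi u + kappa * `|h| + eta].

Lemma separated_normals (S1 S2 : set Z) (z1 z2 a1 a2 : Z) (kappa rho : R) :
  seq_complete S1 -> seq_complete S2 -> 0 < rho -> 0 < kappa -> kappa < 1 ->
  S1 a1 -> S2 a2 ->
  `|a1 - z1| < kappa / 256 * rho -> `|a2 - z2| < kappa / 256 * rho ->
  (forall u1 u2, S1 u1 -> S2 u2 -> u1 - z1 = u2 - z2 -> `|u1 - z1| < rho -> False) ->
  exists (u1 u2 : Z) (f1 f2 : dual Z), [/\ `|u1 - a1| < rho, `|u2 - a2| < rho,
    N S1 u1 f1, N S2 u2 f2 &
    (forall t, f1 t + f2 t <= 2 * kappa * `|t|) /\
    exists2 d, 0 < `|d| & (1 - 3 * kappa) * `|d| <= f1 d].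
Proof.
move=> S1c S2c rho0 k0 k1 Sa1 Sa2 a1z a2z empty.
pose c := z1 - z2; pose phi0 (u : Z * Z) := `|u.1 - u.2 - c|.
have swap (a b a' b' : Z) : a - b - (a' - b') = a - a' - (b - b').
  by rewrite opprD addrACA -opprD.
have subK (a b w : Z) : a - w - (b - w) = a - b by rewrite opprB addrA subrK.
pose S := S1 `*` S2.
have Sc : seq_complete S by exact: seq_complete_prod.
have dK (a b w : Z) : a - w - b - c = a - b - c - w.
  by rewrite -!addrA; congr (_ + _); rewrite addrC -addrA.
have phi0L : lipschitz_fun 2 phi0.
  move=> u v; rewrite addrC -lerBlDr (le_trans (lerB_dist _ _))// subK swap.
  rewrite (le_trans (ler_normB _ _))//.
  by have [h1 h2] := norm_fst_snd (u - v); rewrite mulr2n mulrDl mul1r lerD.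
have phi0c : convex_on phi0.
  move=> t x y t01; apply: le_trans (norm_convex _ _ t01).
  rewrite le_eqVlt; apply/orP; left; apply/eqP; congr `|_|.
  rewrite -[_.1 - _]/(t *: x.1 + (1 - t) *: y.1 - (t *: x.2 + (1 - t) *: y.2)).
  rewrite !(scalerBr t) !(scalerBr (1 - t)) [RHS]addrACA; congr (_ + _); last first.
    by rewrite -!scalerBr -opprD -scalerDl subrKC scale1r.
  by rewrite opprD addrACA.
have r0 : 0 < rho / 2 by rewrite divr_gt0.
have phi0_ge0 u : 0 <= phi0 u by exact: normr_ge0.
(* Origin of 256: two distances below [kappa * rho / 256] add up to the starting error that the
   variational principle allows with radius [rho / 2]. *)
have start : phi0 (a1, a2) <= kappa * (rho / 2) / 64.
  rewrite /phi0 /= swap (le_trans (ler_normB _ _))//; lra.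
have [||||G [v [Gc GL [Sv1 Sv2] va [vmin _]]]] := @variational_principle R (Z * Z)%type phi0 2 S
    (a1, a2) kappa (rho / 2) (fun _ u => `|u|) phi0L Sc (conj Sa1 Sa2) k0 r0.
- by move=> s _ _; rewrite (le_trans start)// lerDr.
- by move=> a _; exact: norm_convex.
- by move=> a _; exact: norm_lipschitz.
- by move=> a x a0; rewrite lerDl (ltW a0) andbT gerBl ltW.
have va1 : `|v.1 - a1| < rho / 2 by exact: le_lt_trans (norm_fst_snd (v - (a1, a2))).1 va.
have va2 : `|v.2 - a2| < rho / 2 by exact: le_lt_trans (norm_fst_snd (v - (a1, a2))).2 va.
have m0 : 0 < phi0 v.
  rewrite lt_neqAle phi0_ge0 andbT eq_sym; apply/negP; rewrite normr_eq0 swap subr_eq0 => /eqP e.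
  apply: (empty _ _ Sv1 Sv2 e); rewrite -(subrKA a1) (le_lt_trans (ler_normD _ _))//.
  have : kappa / 256 * rho <= rho / 256.
    by rewrite mulrAC ler_pM2r// ger_pMl// ltW.
  lra.
pose r1 := Num.min (rho / 2 - `|v - (a1, a2)|) (phi0 v / 4).
have r10 : 0 < r1 by rewrite lt_min subr_gt0 va divr_gt0.
pose eta := kappa * phi0 v / 2.
have eta0 : 0 < eta by rewrite divr_gt0// mulr_gt0.
have phiL : lipschitz_fun (2 + kappa) (fun u => phi0 u + G u).
  by move=> x y; have := phi0L x y; have := GL x y; rewrite mulrDl; lra.
have [|s Ss sr|u [f [[Su1 Su2] uv fN fP]]] := N_min Sc (convex_onD phi0c Gc) phiL _
    (conj Sv1 Sv2) r10 k0 eta0.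
- by rewrite addr_ge0// ltW.
- apply: vmin => //; rewrite -(subrKA v) (le_trans (ler_normD _ _))//.
  move: sr; rewrite le_min => /andP[h _]; lra.
have [g1 [g2 gE]] := dual_prod_split (- f).
have fE h : f h = - (g1 h.1 + g2 h.2).
  by rewrite -[f]opprK gE.
rewrite gE in fN; have [N1 N2] := N_prod fN.
have fP' h : - (g1 h.1 + g2 h.2) <= phi0 (u + h) - phi0 u + 2 * kappa * `|h| + eta.
  rewrite -fE; have := fP h; have := GL (u + h) u.
  rewrite (addrAC u) subrr add0r.
  move: (f h : R) (phi0 (u + h)) (phi0 u) (G (u + h)) (G u) `|h| => x0 x1 x2 x3 x4 x5; lra.
have ua1 : `|u.1 - a1| < rho.
  have := (norm_fst_snd (u - v)).1 => /= h1; rewrite -(subrKA v.1) (le_lt_trans (ler_normD _ _))//.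
  move: uv; rewrite lt_min => /andP[h2 _]; have := normr_ge0 (v - (a1, a2)); lra.
have ua2 : `|u.2 - a2| < rho.
  have := (norm_fst_snd (u - v)).2 => /= h1; rewrite -(subrKA v.2) (le_lt_trans (ler_normD _ _))//.
  move: uv; rewrite lt_min => /andP[h2 _]; have := normr_ge0 (v - (a1, a2)); lra.
have um : phi0 v / 2 <= phi0 u.
  have := phi0L v u; rewrite distrC; move: uv; rewrite lt_min => /andP[_ h]; lra.
exists u.1, u.2, g1, g2; split=> //; split.
- move=> t; apply/ler_addgt0Pr => e e0.
  (* [phi0] does not change along the diagonal, so the test vector can be scaled by [s], reducing
     [eta] to [e] after division. *)
  pose s := eta / e; have s0 : 0 < s by rewrite divr_gt0.
  have := fP' (- (s *: t), - (s *: t)).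
  have -> : phi0 (u + (- (s *: t), - (s *: t))) = phi0 u.
    by rewrite /phi0 /= subK.
  rewrite /= !dualN subrr add0r.
  rewrite !dualZ.
  rewrite prod_normE /= normrN maxxx normrZ gtr0_norm// => h.
  rewrite -(ler_pM2l s0); move: h.
  have : s * e = eta by rewrite /s; field; rewrite gt_eqF.
  move: s s0 (g1 t : R) (g2 t : R) `|t| => s _ x1 x2 x3 se; rewrite !mulrDr se; lra.
(* Moving the first point by this vector brings [phi0] from [phi0 u], the length of the vector, down
   to 0. *)
- exists (- (u.1 - u.2 - c)); first by rewrite normrN (lt_le_trans _ um)// divr_gt0.
  have := fP' (- (u.1 - u.2 - c), 0).
  have -> : phi0 (u + (- (u.1 - u.2 - c), 0)) = 0.
    by rewrite /phi0 /= addr0 dK subrr normr0.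
  rewrite prod_normE /= normr0 normrN max_l// (linear0 g2) !dualN addr0.
  rewrite -/(phi0 u) /eta => h; have := ler_wpM2l (ltW k0) um.
  move: h; move: (g1 _ : R) (phi0 u) => x1 x2; lra.
Qed.

Hypothesis N_mem : forall (V : normedModType R) (S : set V) z (f : dual V), N S z f -> S z.

Lemma stationary_multiplier (N' : forall V : normedModType R, set V -> V -> set (dual V))
    (Omega : set X) (F : X -> set Y) (xbar : X) (ybar : Y) (L : Y -> set Y) (delta : R) :
  (forall V S z f, @N V S z f -> N' V S z f) ->
  closed Omega -> closed (gph F) ->
  qualification N' F Omega xbar ybar ->
  triple_approx_stationary F Omega (Xi_delta L ybar delta) xbar ybar ->
  exists2 M : R, 0 < M & forall eps : R, 0 < eps ->
     exists (x1 : X) (y1 : Y) (x2 : X) (y y2 : Y) (ys : dual Y),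
       [/\ (gph F `&` ball (xbar, ybar) eps) (x1, y1),
           (Omega `&` ball xbar eps) x2,
           (L_minus L ybar `&` ball ybar delta) y,
           (closure (L y) `&` ball ybar eps) y2 &
           [/\ minkowski_sum (N' _ (closure (L y)) y2) (ball 0 eps) ys,
               `|ys| = 1 &
               minkowski_sum
                 (minkowski_sum (coderivative N' F x1 y1 ys)
                    (N' _ Omega x2 `&` ball 0 M))
                 (ball 0 eps) 0]].
Proof.
move=> NN' Ocl Fcl [e0 e00 qc] stat.
(* After division by |b|, the bound [e0 |c| <= |b|] becomes [e0^-1], independent of [eps]; the 1
   makes it strict for the open ball. *)
exists (e0^-1 + 1); first by rewrite addr_gt0// invr_gt0.
move=> eps eps0.
pose c0 := e0 / (2 * (1 + e0)).
have e01 : 0 < 1 + e0 by rewrite addr_gt0.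
have c00 : 0 < c0 by rewrite divr_gt0// mulr_gt0.
pose kappa := Num.min (Num.min (1 / 12) (e0 / 8)) (Num.min (c0 / 2) (eps * c0 / 4)).
have k0 : 0 < kappa.
  by rewrite !lt_min !divr_gt0// mulr_gt0.
have k1 : kappa <= 1 / 12 by rewrite !ge_min lexx.
have k256 : kappa / 256 <= 1 by lra.
have k2 : kappa <= e0 / 8 by rewrite !ge_min lexx orbT.
have k3 : kappa <= c0 / 2 by rewrite !ge_min lexx !orbT.
have k4 : kappa <= eps * c0 / 4 by rewrite !ge_min lexx !orbT.
pose e' := Num.min (kappa / 256) (Num.min (eps / 4) (e0 / 4)).
have e'0 : 0 < e' by rewrite !lt_min !divr_gt0.
have e'1 : e' <= kappa / 256 by rewrite ge_min lexx.
have e'2 : e' <= eps / 4 by rewrite !ge_min lexx !orbT.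
have e'3 : e' <= e0 / 4 by rewrite !ge_min lexx !orbT.
have [rho [A [z [/andP[rho0 rhoe] Xi zb dmax inter]]]] := stat e' e'0.
have A0 : A ord0 = gph F by exact: (Xi ord0).
have := Xi (lift ord0 ord0); rewrite /= => -[_ [y yL <-] A1].
have near_set i : exists2 a, A i a & `|a - z i| < kappa / 256 * rho.
  have : (dist_set (z i) (A i) < (e' * rho)%:E)%E.
    apply: le_lt_trans dmax; exact: le_bigmax.
  move=> /ereal_inf_lt[_ [a Aa <-]]; rewrite lte_fin => h.
  exists a => //; apply: lt_le_trans h _; by rewrite ler_pM2r.
have [a1 Aa1 a1z] := near_set ord0; have [a2 Aa2 a2z] := near_set (lift ord0 ord0).
set z1 := z ord0 in a1z; set z2 := z (lift ord0 ord0) in a2z.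
rewrite A0 in Aa1; rewrite -A1 in Aa2.
have XY : seq_complete [set: Z].
  by rewrite -setXTT; apply: seq_complete_prod; exact: seq_complete_setT.
have S1c : seq_complete (gph F) by exact: closed_seq_complete.
have S2c : seq_complete (Omega `*` closure (L y)).
  apply: seq_complete_prod; apply: closed_seq_complete => //.
  - exact: seq_complete_setT.
  - exact: seq_complete_setT.
  - exact: closed_closure.
have [|u1 u2 Su1 Su2 e u1z|[x1 y1] [[x2 y2] [f1 [f2 [ua1 ua2 N1 N2 [fsum [d d0 fd]]]]]]] :=
  separated_normals S1c S2c rho0 k0
    _ Aa1 Aa2 a1z a2z.
- lra.
- have : (\bigcap_i [set a - z i | a in A i] `&` ball 0 rho) (u1 - z1).
    split; last by rewrite -ball_normE /= sub0r normrN.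
    move=> i _; have [->|i0] := eqVneq i ord0; first by exists u1; rewrite ?A0.
    have -> : i = lift ord0 ord0 by case: (unliftP ord0 i) i0 => [j ->|->]; rewrite ?eqxx// ord1.
    by exists u2; rewrite -?A1 ?e.
  by rewrite inter.
have [a [b f1E]] := dual_prod_split f1; have [c [g f2E]] := dual_prod_split f2.
subst f1 f2; have [N3 N4] := N_prod N2; move: N3 N4 => /= N3 N4.
have Fx1 := N_mem N1; have Ox2 := N_mem N3; have Ly2 := N_mem N4.
have nearz i (w ai : Z) : `|w - ai| < rho -> `|ai - z i| < kappa / 256 * rho ->
    `|(xbar, ybar) - w| < eps /\ `|(xbar, ybar) - w| < e0.
  move=> h1 h2; have := zb i; rewrite -ball_normE /= => h3.
  have h4 : kappa / 256 * rho <= rho by rewrite ger_pMl.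
  have h5 : `|(xbar, ybar) - w| <= `|(xbar, ybar) - z i| + (`|ai - z i| + `|w - ai|).
    rewrite -(subrKA (z i)) (le_trans (ler_normD _ _))// lerD2l.
    by rewrite -(subrKA ai) (le_trans (ler_normD _ _))// (distrC (z i) ai) (distrC ai w).
  move: h1 h2 h3 h4 h5 rhoe e'2 e'3 eps0 e00; clear.
  move: `|_| `|_| `|_| `|_| (kappa / 256 * rho) => q1 q2 q3 q4 q5; split; lra.
have [w1e w1e0] := nearz _ _ _ ua1 a1z; have [w2e w2e0] := nearz _ _ _ ua2 a2z.
have x2n : `|xbar - x2| <= `|(xbar, ybar) - (x2, y2)|.
  exact: (norm_fst_snd ((xbar, ybar) - (x2, y2))).1.
have y2n : `|ybar - y2| <= `|(xbar, ybar) - (x2, y2)|.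
  exact: (norm_fst_snd ((xbar, ybar) - (x2, y2))).2.
have K0 : 0 <= 2 * kappa by rewrite mulr_ge0// ltW.
have ac : `|a + c| <= 2 * kappa.
  apply: dual_norm_le_mul => // x; have := fsum (x, 0).
  by rewrite prod_normE /= (linear0 b) (linear0 g) !addr0 normr0 max_l.
have bg : `|b + g| <= 2 * kappa.
  apply: dual_norm_le_mul => // x; have := fsum (0, x).
  by rewrite prod_normE /= (linear0 a) (linear0 c) !add0r normr0 max_r.
have ab : 1 - 3 * kappa <= `|a| + `|b|.
  rewrite -(ler_pM2r d0) (le_trans fd)//= mulrDl.
  have [n1 n2] := norm_fst_snd d.
  apply: lerD; apply: le_trans (ler_norm _) (le_trans (dual_le_norm _ _) _).
    exact: ler_wpM2l n1.
  exact: ler_wpM2l n2.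
have bc : c0 <= `|b| /\ e0 * `|c| <= `|b|.
  (* If |b| is less than [e0 * (|a| + |c|)], normalising by |a| + |c| puts the [Y]-component into
     the ball of radius [e0], and the qualification condition yields
     [e0 * (|a| + |c|) <= |a + c| <= 2 * kappa]. *)
  apply: (multiplier_bounds (na := `|a|) e00) ab _ => // h.
  pose s := `|a| + `|c|.
  have s0 : 0 < s.
    rewrite lt_neqAle addr_ge0// andbT eq_sym; apply/negP => /eqP s0.
    by move: h; rewrite -/s s0 mulr0 ltNge normr_ge0.
  have t0 : 0 < s^-1 by rewrite invr_gt0.
  have B1 : ball (xbar, ybar) e0 (x1, y1) by rewrite -ball_normE.
  have B2 : ball xbar e0 x2 by rewrite -ball_normE /=; exact: le_lt_trans x2n w2e0.
  have B3 : (\bigcup_(ys in ball (0 : dual Y) e0) coderivative N' F x1 y1 ys) (s^-1 *: a).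
    exists (- (s^-1 *: b)); last first.
      by rewrite /coderivative /= opprK -dual_pairZ; exact/NN'/N_scale.
    rewrite -ball_normE /= sub0r opprK normrZ gtr0_norm//.
    by rewrite ltr_pdivrMl// mulrC.
  have Q : e0 <= s^-1 * `|a + c|.
    rewrite -[s^-1](gtr0_norm t0) -normrZ scalerDr.
    apply: qc (conj Fx1 B1) (conj Ox2 B2) B3 (NN' _ _ _ _ (N_scale t0 N3)) _.
    by rewrite !normrZ !gtr0_norm// -mulrDr mulVf// gt_eqF.
  by rewrite mulrC -ler_pdivlMl// (le_trans Q)// ler_pM2l.
move: bc => [bc0 ebc]; have b0 : 0 < `|b| by exact: lt_le_trans bc0.
have t0 : 0 < `|b|^-1 by rewrite invr_gt0.
have small q : q <= 2 * kappa -> `|b|^-1 * q < eps.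
  move=> h; rewrite ltr_pdivrMl//; have : eps * c0 <= eps * `|b| by rewrite ler_pM2l.
  have : 0 < eps * c0 by exact: mulr_gt0.
  lra.
(* The sign is that of the coderivative: the pair (a, b) is normal to the graph. As [b + g] is
   small, the unit vector is close to [g] divided by |b|, which is normal to the closure of
   [L y]. *)
exists x1, y1, x2, y, y2, (- (`|b|^-1 *: b)); split.
- by split=> //; rewrite -ball_normE.
- by split=> //; rewrite -ball_normE /=; exact: le_lt_trans x2n w2e.
- exact: yL.
- by split=> //; rewrite -ball_normE /=; exact: le_lt_trans y2n w2e.
- split; last 2 first.
  + by rewrite normrN normrZ gtr0_norm// mulVf// gt_eqF.
  + exists (`|b|^-1 *: a + `|b|^-1 *: c).
      exists (`|b|^-1 *: a).
        rewrite /coderivative /= opprK -dual_pairZ; exact/NN'/N_scale.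
      exists (`|b|^-1 *: c) => //; split; first exact/NN'/N_scale.
      rewrite -ball_normE /= sub0r normrN normrZ gtr0_norm// ltr_pdivrMl//.
      rewrite mulrDr mulr1; apply: le_lt_trans (_ : `|b| * e0^-1 < _); last by rewrite ltrDl.
      by rewrite ler_pdivlMr// mulrC.
    exists (- (`|b|^-1 *: a + `|b|^-1 *: c)); last by rewrite subrr.
    rewrite -ball_normE /= sub0r opprK -scalerDr normrZ gtr0_norm//; exact: small.
  + exists (`|b|^-1 *: g); first exact/NN'/N_scale.
    exists (- (`|b|^-1 *: b) - `|b|^-1 *: g); last by rewrite subrKC.
    rewrite -ball_normE /= sub0r opprB opprK -scalerDr normrZ gtr0_norm// addrC; exact: small.
Qed.

End Assembly.

Theorem corollary4p2 (R : realType) (X Y : completeNormedModType R)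
    (Omega : set X) (F : X -> set Y) (xbar : X) (ybar : Y)
    (L : Y -> set Y) (delta : R) :
  closed Omega -> closed (gph F) -> Omega xbar -> F xbar ybar -> 0 < delta ->
  (QC_C F Omega xbar ybar ->
   triple_approx_stationary F Omega (Xi_delta L ybar delta) xbar ybar ->
   exists2 M : R, 0 < M & forall eps : R, 0 < eps ->
     exists (x1 : X) (y1 : Y) (x2 : X) (y y2 : Y) (ys : dual Y),
       [/\ (gph F `&` ball (xbar, ybar) eps) (x1, y1),
           (Omega `&` ball xbar eps) x2,
           (L_minus L ybar `&` ball ybar delta) y,
           (closure (L y) `&` ball ybar eps) y2 &
           [/\ minkowski_sum (clarke_normal (closure (L y)) y2) (ball 0 eps) ys,
               `|ys| = 1 &
               minkowski_sum
                 (minkowski_sum (clarke_coderivative F x1 y1 ys)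
                    (clarke_normal Omega x2 `&` ball 0 M))
                 (ball 0 eps) 0]]) /\
  (asplund X -> asplund Y ->
   QC_F F Omega xbar ybar ->
   triple_approx_stationary F Omega (Xi_delta L ybar delta) xbar ybar ->
   exists2 M : R, 0 < M & forall eps : R, 0 < eps ->
     exists (x1 : X) (y1 : Y) (x2 : X) (y y2 : Y) (ys : dual Y),
       [/\ (gph F `&` ball (xbar, ybar) eps) (x1, y1),
           (Omega `&` ball xbar eps) x2,
           (L_minus L ybar `&` ball ybar delta) y,
           (closure (L y) `&` ball ybar eps) y2 &
           [/\ minkowski_sum (frechet_normal (closure (L y)) y2) (ball 0 eps) ys,
               `|ys| = 1 &
               minkowski_sum
                 (minkowski_sum (frechet_coderivative F x1 y1 ys)
                    (frechet_normal Omega x2 `&` ball 0 M))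
                 (ball 0 eps) 0]]).
Proof.
move=> Ocl Fcl _ _ _; split=> [qc stat|Xasp Yasp qc stat].
- apply: (@stationary_multiplier R X Y (@clarke_normal R)) qc stat => //.
  + by move=> A B S T z f g; exact: clarke_normal_prod.
  + by move=> V S z t f; exact: clarke_normal_scale.
  + move=> S phi C r kappa eta ubar _ phic phiL C0 Su r0 k0 eta0 phimin.
    have [f [fN fP]] := clarke_min phic phiL C0 Su r0 phimin.
    exists ubar, f; split=> // [|h]; first by rewrite subrr normr0.
    apply: le_trans (fP h) _; rewrite -addrA lerDl addr_ge0// ?mulr_ge0// ltW//.
  + by move=> V S z f [].
- apply: (@stationary_multiplier R X Y (@fnormal R) _ _ _ _ (@frechet_normal R)) qc stat => //.
  + by move=> A B S T z f g; exact: fnormal_prod.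
  + by move=> V S z t f; exact: fnormal_scale.
  + move=> S phi C r kappa eta ubar Sc phic phiL C0 Su r0 k0 eta0 phimin.
    have Z : separable_duals (X * Y)%type by exact: separable_duals_prod.
    have [u [f [uu fN fP]]] := fuzzy_min phic phiL C0 k0 eta0 (separable_duals_prod Z Z)
      Sc Su r0 phimin.
    by exists u, f; split=> //; exact: fN.1.
  + by move=> V S z f [].
  + by move=> V S z f; exact: fnormal_frechet.
Qed.
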